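(* Let $\Lambda\in\{-1,0,1\}$ and let $L$ be a lightlike tetrahedron in $\mathbb X_\Lambda$ with vertices $x_1,x_2,x_3,x_4$. Then there is a unique isometry $A\in\mathrm{PGL}^+(2,\mathbb C_\Lambda)$ and parameters $\alpha,\beta,\gamma\in\mathbb R$ with $\alpha+\beta+\gamma=0$ such that, as points of $\mathbb X_\Lambda$ (i.e. up to real rescaling of matrices), $$A\rhd x_1=\begin{pmatrix}e^{\ell\alpha}&-2\ell s_\Lambda(\alpha)\\0&e^{-\ell\alpha}\end{pmatrix},\quad A\rhd x_2=\begin{pmatrix}e^{\ell\beta}&0\\2\ell s_\Lambda(\beta)&e^{-\ell\beta}\end{pmatrix},\quad A\rhd x_3=\begin{pmatrix}e^{-\ell\gamma}&0\\0&e^{\ell\gamma}\end{pmatrix},\quad A\rhd x_4=\begin{pmatrix}1&0\\0&1\end{pmatrix}.$$ For $\Lambda=1$ one can choose $0<|\alpha|,|\beta|,|\gamma|<\pi$.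
   Context: $\mathbb C_\Lambda=\mathbb R[\ell]/(\ell^2+\Lambda)$, with $\overline{x+\ell y}=x-\ell y$, $|z|^2=z\overline z$; $e^{\ell\theta}=c_\Lambda(\theta)+\ell s_\Lambda(\theta)$, so $s_\Lambda=\sinh,\ \theta\mapsto\theta,\ \sin$ for $\Lambda=-1,0,1$. Put $\begin{pmatrix}a&b\\c&d\end{pmatrix}^\circ=\begin{pmatrix}\overline d&-\overline b\\-\overline c&\overline a\end{pmatrix}$. $\mathbb X_\Lambda=\{x\in\mathrm{Mat}(2,\mathbb C_\Lambda):x^\circ=x,\ \det x>0\}/\mathbb R^\times$ (3d anti-de Sitter, Minkowski, de Sitter space for $\Lambda=-1,0,1$). $\mathrm{PGL}^+(2,\mathbb C_\Lambda)=\{A\in\mathrm{Mat}(2,\mathbb C_\Lambda):|\det A|^2>0\}/\mathbb C_\Lambda^\times$ acts transitively on $\mathbb X_\Lambda$ by orientation preserving isometries $A\rhd x=AxA^\circ$. Geodesics are the curves $t\mapsto A\rhd\exp(tX)$ with $X\in\mathfrak x_\Lambda=\{X: X^\circ=X,\ \mathrm{tr}X=0\}=\ell\,\mathfrak{sl}(2,\mathbb R)$, and such a geodesic is timelike, lightlike, spacelike if $-\det(\mathrm{Im}X)$ is negative, zero, positive, where $\mathrm{Im}(\ell M)=M$. Geodesic planes are the intersections of $\mathbb X_\Lambda$ with projective planes of the projectivization of $\{x=x^\circ\}\cong\mathbb R^4$; a plane is lightlike if it contains a lightlike but no timelike geodesic. A lightlike tetrahedron is a non-degenerate convex geodesic 3-simplex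 in $\mathbb X_\Lambda$ (the image of a cone $\{\sum_{i=1}^4a_ix_i':a_i\ge0,\sum a_i\neq0\}$ spanned by four linearly independent vectors $x_i'\in\{x=x^\circ\}$, all of whose elements represent points of $\mathbb X_\Lambda$) whose faces lie in lightlike planes and such that all geodesics starting at a vertex and intersecting its interior are spacelike. *)

(* Defs.v *)
From HB Require Import structures.
From mathcomp Require Import all_boot all_order all_algebra.
From mathcomp Require Import all_classical all_reals all_analysis.
Set Implicit Arguments.
Unset Strict Implicit.
Unset Printing Implicit Defensive.
Import Order.TTheory GRing.Theory Num.Theory.
Import numFieldNormedType.Exports.
Local Open Scope classical_set_scope.
Local Open Scope ring_scope.

Definition clpoly (R : realType) (Lam : int) : {poly R} :=
  'X^2 + (Lam%:~R)%:P.

Lemma size_clpoly (R : realType) (Lam : int) : size (clpoly R Lam) = 3%N.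
Proof.
rewrite size_polyDl ?size_polyXn //.
by rewrite (leq_ltn_trans (size_polyC_leq1 _)).
Qed.

(* {poly %/ h} is the quotient by h only when h is monic and nonconstant. *)
Lemma clpoly_monic (R : realType) (Lam : int) :
  mk_monic (clpoly R Lam) = clpoly R Lam.
Proof.
rewrite /mk_monic size_clpoly monicE lead_coefDl ?lead_coefXn ?eqxx //.
by rewrite size_polyXn (leq_ltn_trans (size_polyC_leq1 _)).
Qed.

Notation CL R Lam := {poly %/ clpoly R Lam}.

Section CLambda.
Context {R : realType} {Lam : int}.
Implicit Types (z w : CL R Lam).

Definition ell : CL R Lam := 'qX.

Definition clRe z : R := (z : {poly R})`_0.
Definition clIm z : R := (z : {poly R})`_1.
Definition mkCL (x y : R) : CL R Lam := x%:A + y *: ell.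

Definition clconj z : CL R Lam := mkCL (clRe z) (- clIm z).

(* z * clconj z has no ell-component *)
Definition clnormsq z : R := clRe (z * clconj z).

End CLambda.
Arguments ell {R Lam}.

Section CLambdaFacts.
Context {R : realType} {Lam : int}.
Implicit Types (z w : CL R Lam) (x y : R).

Lemma mkCL_val x y : (mkCL x y : CL R Lam) = x%:P + y *: 'X :> {poly R}.
Proof.
rewrite -[x%:P]alg_polyC.
have : (ell : CL R Lam) = 'X :> {poly R}.
  by rewrite in_qpoly_small // clpoly_monic size_polyX size_clpoly.
by move=> /= ->; rewrite polyC1.
Qed.

Lemma clRe_mk x y : clRe (mkCL x y : CL R Lam) = x.
Proof. by rewrite /clRe mkCL_val coefD coefC coefZ coefX mulr0 addr0. Qed.

Lemma clIm_mk x y : clIm (mkCL x y : CL R Lam) = y.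
Proof. by rewrite /clIm mkCL_val coefD coefC coefZ coefX mulr1 add0r. Qed.

Lemma mkCLK z : mkCL (clRe z) (clIm z) = z.
Proof.
apply/val_inj; rewrite [LHS]mkCL_val; apply/polyP=> i.
rewrite coefD coefC coefZ coefX; case: i => [|[|i]] /=.
- by rewrite mulr0 addr0.
- by rewrite mulr1 add0r.
- rewrite mulr0 addr0 nth_default //.
  by apply: leq_trans (size_npoly z) _; rewrite clpoly_monic size_clpoly.
Qed.

Lemma ell_sq : (ell * ell : CL R Lam) = - (Lam%:~R)%:A.
Proof.
have -> : (Lam%:~R)%:A = in_qpoly (clpoly R Lam) (Lam%:~R)%:P.
  by rewrite -alg_polyC in_qpolyZ in_qpoly1.
rewrite -[RHS]add0r; apply: (canRL (addrK _)).
rewrite -rmorphM -rmorphD -expr2.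
apply: val_inj; rewrite /= clpoly_monic Pdiv.CommonRing.rmodpp //.
exact: mulrC.
Qed.

Lemma mkCLM x y x' y' :
  (mkCL x y * mkCL x' y' : CL R Lam) =
  mkCL (x * x' - Lam%:~R * (y * y')) (x * y' + y * x').
Proof.
rewrite /mkCL scalerBl scalerDl [Lam%:~R * _]mulrC.
rewrite mulrDl !mulrDr -!scalerAl -!scalerAr !mul1r mulr1 ell_sq.
rewrite !scalerN !scalerA.
by rewrite -!addrA; congr (_ + _); rewrite addrA addrC.
Qed.

End CLambdaFacts.

Section Trigonometric.
Context {R : realType} (Lam : int).

Definition cL (t : R) : R :=
  if Lam == -1 then (expR t + expR (- t)) / 2
  else if Lam == 0 then 1 else cos t.
Definition sL (t : R) : R :=
  if Lam == -1 then (expR t - expR (- t)) / 2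
  else if Lam == 0 then t else sin t.
Definition expell (t : R) : CL R Lam := mkCL (cL t) (sL t).

End Trigonometric.

Definition mx2 (T : Type) (a b c d : T) : 'M[T]_2 :=
  \matrix_(i < 2, j < 2)
    if i == 0 then (if j == 0 then a else b) else (if j == 0 then c else d).

Section Spaces.
Context {R : realType} {Lam : int}.
Local Notation C := (CL R Lam).
Local Notation M2 := 'M[C]_2.
Implicit Types (x y A B X : M2).

Definition circ A : M2 :=
  mx2 (clconj (A 1 1)) (- clconj (A 0 1)) (- clconj (A 1 0)) (clconj (A 0 0)).

Definition rscale (r : R) x : M2 := (r%:A : C) *: x.

(* Points of X_Lambda are represented by matrices; det x is real when
   circ x = x. *)
Definition inX x : Prop := circ x = x /\ 0 < clRe (\det x).
Definition samept x y : Prop := exists2 r : R, r != 0 & y = rscale r x.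

Definition inPGLplus A : Prop := 0 < clnormsq (\det A).
Definition samePGL A B : Prop := exists2 z : C, z \is a GRing.unit & B = z *: A.

Definition act A x : M2 := A *m x *m circ A.

Definition inTangent X : Prop := circ X = X /\ \tr X = 0.

(* For X in the tangent space the entries of X have no real part *)
Definition imdet X : R := \det (map_mx clIm X).

(* Matrix exponential, with coordinatewise convergence of the series. *)
Definition expseries X (n : nat) : M2 :=
  \sum_(0 <= k < n) rscale (k`!%:R^-1) (X ^+ k).
Definition mexp X : M2 :=
  \matrix_(i < 2, j < 2)
    mkCL (limn (fun n => clRe (expseries X n i j)))
         (limn (fun n => clIm (expseries X n i j))).

(* Constant curves (X = 0) are not geodesics. *)
Definition isGeodesic A X : Prop := [/\ inPGLplus A, inTangent X & X != 0].
Definition geodesic A X (t : R) : M2 := act A (mexp (rscale t X)).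

Definition timelike X : Prop := - imdet X < 0.
Definition lightlike X : Prop := - imdet X = 0.
Definition spacelike X : Prop := 0 < - imdet X.

Definition rcomb n (a : 'I_n -> R) (x : 'I_n -> M2) : M2 :=
  \sum_(i < n) rscale (a i) (x i).
Definition rfree n (x : 'I_n -> M2) : Prop :=
  forall a : 'I_n -> R, rcomb a x = 0 -> forall i, a i = 0.

(* The linear subspaces of dimension 3 of the real vector space
   {x | circ x = x}, i.e. the planes of its projectivization. *)
Definition isPlane (W : set M2) : Prop :=
  exists w : 'I_3 -> M2, [/\ forall i, circ (w i) = w i, rfree w
    & W = [set x | exists a : 'I_3 -> R, x = rcomb a w]].

Definition contains (W : set M2) A X : Prop := forall t, W (geodesic A X t).

Definition lightlike_plane (W : set M2) : Prop :=
  [/\ isPlane W,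
      exists A X, [/\ isGeodesic A X, lightlike X & contains W A X]
    & ~ exists A X, [/\ isGeodesic A X, timelike X & contains W A X]].

(* Matrices representing a point in the face opposite to the vertex i,
   resp. in the interior, of the image of the cone spanned by v. *)
Definition face (v : 'I_4 -> M2) (i : 'I_4) : set M2 :=
  [set x | exists a : 'I_4 -> R,
     [/\ forall j, 0 <= a j, a i = 0, \sum_j a j != 0 & samept (rcomb a v) x]].
Definition simplex_interior (v : 'I_4 -> M2) : set M2 :=
  [set x | exists2 a : 'I_4 -> R,
     forall j, 0 < a j & samept (rcomb a v) x].

Definition geodesic_simplex (v : 'I_4 -> M2) : Prop :=
  [/\ forall i, circ (v i) = v i, rfree v
    & forall a : 'I_4 -> R, (forall j, 0 <= a j) -> \sum_j a j != 0 ->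
        inX (rcomb a v)].

Definition lightlike_tetrahedron (v : 'I_4 -> M2) : Prop :=
  [/\ geodesic_simplex v,
      forall i, exists2 W, lightlike_plane W & face v i `<=` W
    & forall i A X, isGeodesic A X -> samept (v i) (geodesic A X 0) ->
        (exists2 t, 0 <= t & simplex_interior v (geodesic A X t)) ->
        spacelike X].

Definition normal_position (v : 'I_4 -> M2) A (al be ga : R) : Prop :=
  [/\ samept (mx2 (expell Lam al) (- (2 * ell * (sL Lam al)%:A))
                  0 (expell Lam (- al)))
             (act A (v (inord 0))),
      samept (mx2 (expell Lam be) 0
                  (2 * ell * (sL Lam be)%:A) (expell Lam (- be)))
             (act A (v (inord 1))),
      samept (mx2 (expell Lam (- ga)) 0
                  0 (expell Lam ga))
             (act A (v (inord 2)))
    & samept (mx2 1 0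
                  0 1)
             (act A (v (inord 3)))].

End Spaces.

(* Main.v *)
Require Import Defs.
From mathcomp Require Import all_boot all_order all_algebra.
From mathcomp Require Import all_classical all_reals all_analysis.
From mathcomp Require Import ring lra.
Import Order.TTheory GRing.Theory Num.Theory.
Import numFieldNormedType.Exports.
Set Implicit Arguments.
Unset Strict Implicit.
Unset Printing Implicit Defensive.
Local Open Scope ring_scope.

(* Write circ for the involution and a point as x = p + ell M with M in
   sl(2, R).  Every hyperplane of {x = circ x} is {x | tr (Z x) = 0} for some
   Z = ell u + K with circ Z = - Z, and A pulls it back to the hyperplane of
   circ A * Z * A.  So the vanishing of det Z is invariant, and, tested at a
   point moved to 1, it holds for lightlike planes, uniformly in Lambda.
   After moving x4 to 1, the normals of the three faces through x4 are nilpotent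
   real matrices, i.e. three points of the real projective line, and PGL(2, R)
   moves them to standard position.  Then x1, x2, x3 lie on three fixed lines,
   x_i = p_i + ell t_i E_i, and lightlikeness of the last face reads
   p1 p2 t3 + p1 t2 p3 + t1 p2 p3 = Lambda t1 t2 t3; in polar coordinates
   (p_i, t_i) ~ (c(theta_i), s(theta_i)) this is
   s(theta_1 + theta_2 + theta_3) = 0.  Uniqueness holds because an isometry
   that fixes 1 and preserves the three lines is scalar. *)

(** * Arithmetic of C_Lambda and Hermitian matrices *)

Section CLambdaTheory.
Context {R : realType} {Lam : int}.
Implicit Types (z w : CL R Lam) (x y r : R).

Lemma cl_eq z w : clRe z = clRe w -> clIm z = clIm w -> z = w.
Proof. by move=> eR eI; rewrite -[z]mkCLK -[w]mkCLK eR eI. Qed.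

Lemma mkCLE x y : mkCL x y = x%:A + y%:A * ell :> CL R Lam.
Proof. by rewrite mulr_algl. Qed.

Lemma clReD z w : clRe (z + w) = clRe z + clRe w.
Proof. by rewrite /clRe /= coefD. Qed.

Lemma clImD z w : clIm (z + w) = clIm z + clIm w.
Proof. by rewrite /clIm /= coefD. Qed.

Lemma clReN z : clRe (- z) = - clRe z.
Proof. by rewrite /clRe /= coefN. Qed.

Lemma clImN z : clIm (- z) = - clIm z.
Proof. by rewrite /clIm /= coefN. Qed.

Lemma mulCLE z w : z * w = mkCL (clRe z * clRe w - Lam%:~R * (clIm z * clIm w))
                                (clRe z * clIm w + clIm z * clRe w).
Proof. by rewrite -mkCLM !mkCLK. Qed.

Lemma clReM z w : clRe (z * w) = clRe z * clRe w - Lam%:~R * (clIm z * clIm w).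
Proof. by rewrite mulCLE clRe_mk. Qed.

Lemma clImM z w : clIm (z * w) = clRe z * clIm w + clIm z * clRe w.
Proof. by rewrite mulCLE clIm_mk. Qed.

Lemma algCLE x : x%:A = mkCL x 0 :> CL R Lam.
Proof. by rewrite /mkCL scale0r addr0. Qed.

Lemma clRe_alg x : clRe (x%:A : CL R Lam) = x.
Proof. by rewrite algCLE clRe_mk. Qed.

Lemma clIm_alg x : clIm (x%:A : CL R Lam) = 0.
Proof. by rewrite algCLE clIm_mk. Qed.

Lemma clRe1 : clRe (1 : CL R Lam) = 1.
Proof. by rewrite -[1 in LHS]scale1r clRe_alg. Qed.

Lemma clIm1 : clIm (1 : CL R Lam) = 0.
Proof. by rewrite -[1 in LHS]scale1r clIm_alg. Qed.

Lemma clRe0 : clRe (0 : CL R Lam) = 0.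
Proof. by rewrite -[0 in LHS](scale0r 1) clRe_alg. Qed.

Lemma clIm0 : clIm (0 : CL R Lam) = 0.
Proof. by rewrite -[0 in LHS](scale0r 1) clIm_alg. Qed.

Lemma ellE : ell = mkCL 0 1 :> CL R Lam.
Proof. by rewrite /mkCL scale0r add0r scale1r. Qed.

Lemma clRe_ell : clRe (ell : CL R Lam) = 0.
Proof. by rewrite ellE clRe_mk. Qed.

Lemma clIm_ell : clIm (ell : CL R Lam) = 1.
Proof. by rewrite ellE clIm_mk. Qed.

Lemma clRe_conj z : clRe (clconj z) = clRe z.
Proof. by rewrite clRe_mk. Qed.

Lemma clIm_conj z : clIm (clconj z) = - clIm z.
Proof. by rewrite clIm_mk. Qed.

Definition clE :=
  (clReD, clImD, clReN, clImN, clReM, clImM, clRe_alg, clIm_alg, clRe1, clIm1,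
   clRe0, clIm0, clRe_ell, clIm_ell, clRe_conj, clIm_conj, @clRe_mk R Lam,
   @clIm_mk R Lam).

Lemma clconjD z w : clconj (z + w) = clconj z + clconj w.
Proof. by apply: cl_eq; rewrite !clE; ring. Qed.

Lemma clconjN z : clconj (- z) = - clconj z.
Proof. by apply: cl_eq; rewrite !clE. Qed.

Lemma clconjM z w : clconj (z * w) = clconj z * clconj w.
Proof. by apply: cl_eq; rewrite !clE; ring. Qed.

Lemma clconjK z : clconj (clconj z) = z.
Proof. by apply: cl_eq; rewrite !clE ?opprK. Qed.

Lemma clconj_alg x : clconj (x%:A : CL R Lam) = x%:A.
Proof. by apply: cl_eq; rewrite !clE ?oppr0. Qed.

Lemma clconj0 : clconj (0 : CL R Lam) = 0.
Proof. by apply: cl_eq; rewrite !clE ?oppr0. Qed.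

Lemma clconj1 : clconj (1 : CL R Lam) = 1.
Proof. by apply: cl_eq; rewrite !clE ?oppr0. Qed.

Definition conjE := (clconjD, clconjN, clconjM, clconjK, clconj_alg, clconj0,
  clconj1).

Lemma mul_conj z : z * clconj z = (clnormsq z)%:A.
Proof. by rewrite /clnormsq; apply: cl_eq; rewrite !clE //; ring. Qed.

Lemma clnormsqM z w : clnormsq (z * w) = clnormsq z * clnormsq w.
Proof. by rewrite /clnormsq !clE; ring. Qed.

Lemma clnormsq_alg x : clnormsq (x%:A : CL R Lam) = x ^+ 2.
Proof. by rewrite /clnormsq !clE; ring. Qed.

(** [CL R Lam] can have zero divisors, so invertibility is read off the norm: the inverse is
    [clconj z] divided by [clnormsq z]. *)
Lemma clnormsq_unit z : clnormsq z != 0 -> z \is a GRing.unit.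
Proof.
move=> nz; apply/unitrPr; exists ((clnormsq z)^-1%:A * clconj z).
rewrite mulrCA mul_conj; apply: cl_eq; rewrite !clE; last by ring.
by rewrite !mulr0 subr0 mulVf.
Qed.

Lemma alg_unit x : x != 0 -> (x%:A : CL R Lam) \is a GRing.unit.
Proof. by move=> nz; apply: clnormsq_unit; rewrite clnormsq_alg expf_neq0. Qed.

End CLambdaTheory.


Lemma I2_cases (i : 'I_2) : i = 0 \/ i = 1.
Proof. by case: i => [[|[|//]] lti]; [left | right]; apply: val_inj. Qed.

Lemma mx2_eta (T : Type) (A : 'M[T]_2) :
  A = mx2 (A 0 0) (A 0 1) (A 1 0) (A 1 1).
Proof.
apply/matrixP=> i j; rewrite mxE.
by case: (I2_cases i) => ->; case: (I2_cases j) => ->.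
Qed.

Section Matrices2.
Context {T : comNzRingType}.
Implicit Types (a b c d x y z t : T) (A : 'M[T]_2).

Lemma mx2M a b c d x y z t : mx2 a b c d *m mx2 x y z t =
  mx2 (a * x + b * z) (a * y + b * t) (c * x + d * z) (c * y + d * t).
Proof. by rewrite [LHS]mx2_eta !mxE !big_ord_recl !big_ord0 !mxE /= !addr0. Qed.

Lemma mx2D a b c d x y z t :
  mx2 a b c d + mx2 x y z t = mx2 (a + x) (b + y) (c + z) (d + t).
Proof. by rewrite [LHS]mx2_eta !mxE. Qed.

Lemma mx2N a b c d : - mx2 a b c d = mx2 (- a) (- b) (- c) (- d).
Proof. by rewrite [LHS]mx2_eta !mxE. Qed.

Lemma mx2Z x a b c d : x *: mx2 a b c d = mx2 (x * a) (x * b) (x * c) (x * d).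
Proof. by rewrite [LHS]mx2_eta !mxE. Qed.

Lemma mx2_0 : mx2 0 0 0 0 = 0 :> 'M[T]_2.
Proof. by rewrite [RHS]mx2_eta !mxE. Qed.

Lemma mx2_1 : mx2 1 0 0 1 = 1%:M :> 'M[T]_2.
Proof. by rewrite [RHS]mx2_eta !mxE. Qed.

Lemma mx2_det a b c d : \det (mx2 a b c d) = a * d - b * c.
Proof.
rewrite (expand_det_row _ 0) !big_ord_recl big_ord0 /cofactor !det_mx11 !mxE /=.
by rewrite expr0 expr1; ring.
Qed.

Lemma mx2_tr a b c d : \tr (mx2 a b c d) = a + d.
Proof. by rewrite /mxtrace !big_ord_recl big_ord0 !mxE /= addr0. Qed.

Lemma mx2_inj {a b c d x y z t} : mx2 a b c d = mx2 x y z t ->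
  [/\ a = x, b = y, c = z & d = t].
Proof.
by move=> e; split; [have := congr1 (fun A => A 0 0) e
  | have := congr1 (fun A => A 0 1) e | have := congr1 (fun A => A 1 0) e
  | have := congr1 (fun A => A 1 1) e]; rewrite !mxE.
Qed.

End Matrices2.

Section Circ.
Context {R : realType} {Lam : int}.
Local Notation C := (CL R Lam).
Local Notation M2 := 'M[C]_2.
Implicit Types (x y A B X Z : M2) (r s : R).

Lemma mx2_circ (a b c d : C) :
  circ (mx2 a b c d) = mx2 (clconj d) (- clconj b) (- clconj c) (clconj a).
Proof. by rewrite /circ !mxE. Qed.

Lemma mx2_rscale r (a b c d : C) :
  rscale r (mx2 a b c d) = mx2 (r%:A * a) (r%:A * b) (r%:A * c) (r%:A * d).
Proof. exact: mx2Z. Qed.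

Definition mxE2 := (mx2_circ, mx2_rscale, @mx2M C, @mx2D C, @mx2N C, @mx2Z C,
  @mx2_det C, @mx2_tr C).

Lemma circM A B : circ (A *m B) = circ B *m circ A.
Proof.
rewrite [A]mx2_eta [B]mx2_eta !mxE2.
by congr mx2; rewrite !conjE; ring.
Qed.

Lemma circK A : circ (circ A) = A.
Proof. by rewrite [A]mx2_eta !mxE2 !conjE !opprK. Qed.

Lemma circD A B : circ (A + B) = circ A + circ B.
Proof.
by rewrite [A]mx2_eta [B]mx2_eta !mxE2; congr mx2; rewrite !conjE; ring.
Qed.

Lemma circ_rscale r A : circ (rscale r A) = rscale r (circ A).
Proof. by rewrite [A]mx2_eta !mxE2; congr mx2; rewrite !conjE; ring. Qed.

Lemma circ1 : circ (1%:M : M2) = 1%:M.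
Proof. by rewrite -mx2_1 mxE2 !conjE oppr0. Qed.

Lemma det_circ A : \det (circ A) = clconj (\det A).
Proof. by rewrite [A]mx2_eta !mxE2 !conjE; ring. Qed.

Lemma rscaleM r s A : rscale r (rscale s A) = rscale (r * s) A.
Proof. by rewrite /rscale scalerA -scalerAl mul1r scalerA. Qed.

Lemma rscale1 A : rscale 1 A = A.
Proof. by rewrite /rscale !scale1r. Qed.

Lemma rscale0 A : rscale 0 A = 0.
Proof. by rewrite /rscale !scale0r. Qed.

Lemma rscalerl r A B : rscale r A *m B = rscale r (A *m B).
Proof. by rewrite /rscale -scalemxAl. Qed.

Lemma rscalerr r A B : A *m rscale r B = rscale r (A *m B).
Proof. by rewrite /rscale -scalemxAr. Qed.

Lemma act_rscale A r x : act A (rscale r x) = rscale r (act A x).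
Proof. by rewrite /act rscalerr rscalerl. Qed.

Lemma actM A B x : act (A *m B) x = act A (act B x).
Proof. by rewrite /act circM !mulmxA. Qed.

Lemma circ_act A x : circ x = x -> circ (act A x) = act A x.
Proof. by move=> ex; rewrite /act !circM circK ex mulmxA. Qed.

Lemma circZ (z : C) A : circ (z *: A) = clconj z *: circ A.
Proof. by rewrite [A]mx2_eta !mxE2; congr mx2; rewrite !conjE; ring. Qed.

Lemma act_scale (z : C) A x : act (z *: A) x = rscale (clnormsq z) (act A x).
Proof.
by rewrite /rscale -mul_conj /act circZ -!scalemxAl -scalemxAr scalerA mulrC.
Qed.

Lemma act1 x : act 1%:M x = x.
Proof. by rewrite /act circ1 mul1mx mulmx1. Qed.

(** Adjugates stand in for inverses: [\adj A *m A] is the scalar [\det A], and a scalar acts through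
    its real norm, which does not move points. *)
Lemma act_adj A x : act (\adj A) (act A x) = rscale (clnormsq (\det A)) x.
Proof. by rewrite -actM mul_adj_mx -scalemx1 act_scale act1. Qed.

Lemma det_act A x : \det (act A x) = (clnormsq (\det A))%:A * \det x.
Proof. by rewrite /act !det_mulmx det_circ -mul_conj; ring. Qed.

Lemma inPGLplusM A B : inPGLplus A -> inPGLplus B -> inPGLplus (A *m B).
Proof. by rewrite /inPGLplus det_mulmx clnormsqM; apply: mulr_gt0. Qed.

Lemma inPGLplus_adj A : inPGLplus A -> inPGLplus (\adj A).
Proof.
rewrite /inPGLplus => pA; have := congr1 (fun M => \det M) (mul_mx_adj A).
rewrite det_mulmx det_scalar => /(congr1 clnormsq).
rewrite clnormsqM expr2 clnormsqM => /(mulfI (lt0r_neq0 pA)) -> //.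
Qed.

(* [p + ell M] and [ell u + K] with M = [[q, r], [s, -q]] and
   K = [[k, l], [n, -k]]: the eigenspaces of [circ] for 1 and -1. *)
Definition herm (p q r s : R) : M2 :=
  mx2 (mkCL p q) (mkCL 0 r) (mkCL 0 s) (mkCL p (- q)).
Definition aherm (u k l n : R) : M2 :=
  mx2 (mkCL k u) (mkCL l 0) (mkCL n 0) (mkCL (- k) u).

Lemma circ_herm p q r s : circ (herm p q r s) = herm p q r s.
Proof.
by rewrite /herm mxE2; congr mx2; apply: cl_eq; rewrite !clE ?opprK ?oppr0.
Qed.

Lemma circ_aherm u k l n : circ (aherm u k l n) = - aherm u k l n.
Proof.
by rewrite /aherm !mxE2; congr mx2; apply: cl_eq; rewrite !clE ?opprK ?oppr0.
Qed.

Lemma hermE x : circ x = x ->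
  x = herm (clRe (x 0 0)) (clIm (x 0 0)) (clIm (x 0 1)) (clIm (x 1 0)).
Proof.
rewrite /herm => ex; have /mx2_inj[e1 e2 e3 e4] := eq_trans ex (mx2_eta x).
apply: (eq_trans (mx2_eta x)); congr mx2; rewrite ?mkCLK //.
- apply: cl_eq; rewrite !clE //.
  by move: (congr1 clRe e2); rewrite !clE; lra.
- apply: cl_eq; rewrite !clE //.
  by move: (congr1 clRe e3); rewrite !clE; lra.
Qed.

Lemma ahermE Z : circ Z = - Z ->
  Z = aherm (clIm (Z 0 0)) (clRe (Z 0 0)) (clRe (Z 0 1)) (clRe (Z 1 0)).
Proof.
rewrite /aherm => ex.
have /mx2_inj[] := eq_trans ex (mx2_eta (- Z)); rewrite !mxE => e1 e2 e3 e4.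
apply: (eq_trans (mx2_eta Z)); congr mx2; rewrite ?mkCLK //.
- apply: cl_eq; rewrite !clE //.
  by move: (congr1 clIm e2); rewrite !clE; lra.
- apply: cl_eq; rewrite !clE //.
  by move: (congr1 clIm e3); rewrite !clE; lra.
- by rewrite -[Z 1 1]opprK -e4; apply: cl_eq; rewrite !clE ?opprK.
Qed.

Lemma det_herm p q r s :
  \det (herm p q r s) = (p ^+ 2 + Lam%:~R * (q ^+ 2 + r * s))%:A.
Proof. by rewrite /herm mxE2; apply: cl_eq; rewrite !clE; ring. Qed.

Lemma det_aherm u k l n :
  \det (aherm u k l n) = (- (Lam%:~R * u ^+ 2 + k ^+ 2 + l * n))%:A.
Proof. by rewrite /aherm mxE2; apply: cl_eq; rewrite !clE; ring. Qed.

(** The pairing of the two eigenspaces has no real part, so each trace condition is a single real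
    equation. *)
Lemma tr_aherm_herm u k l n p q r s :
  \tr (aherm u k l n *m herm p q r s) =
  mkCL 0 (2 * u * p + 2 * k * q + l * s + n * r).
Proof. by rewrite /herm /aherm !mxE2; apply: cl_eq; rewrite !clE; ring. Qed.

Lemma rscale_herm a p q r s :
  rscale a (herm p q r s) = herm (a * p) (a * q) (a * r) (a * s).
Proof. by rewrite /herm !mxE2; congr mx2; apply: cl_eq; rewrite !clE; ring. Qed.

Lemma rscale_aherm a u k l n :
  rscale a (aherm u k l n) = aherm (a * u) (a * k) (a * l) (a * n).
Proof.
by rewrite /aherm !mxE2; congr mx2; apply: cl_eq; rewrite !clE; ring.
Qed.

Lemma herm1 : herm 1 0 0 0 = 1%:M.
Proof.
by rewrite -mx2_1 /herm; congr mx2; apply: cl_eq; rewrite !clE ?oppr0.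
Qed.

End Circ.

(** * Real hyperplanes and the matrix exponential *)

Section RealSpan.
Context {R : realType} {Lam : int}.
Local Notation C := (CL R Lam).
Local Notation M2 := 'M[C]_2.
Implicit Types (x Z : M2).

(** Real coordinates on the fixed space of [circ], so that rank arguments run over the field [R]. *)
Definition hermrow x : 'rV[R]_4 :=
  \row_i [:: clRe (x 0 0); clIm (x 0 0); clIm (x 0 1); clIm (x 1 0)]`_i.

Lemma hermrow_inj x y :
  circ x = x -> circ y = y -> hermrow x = hermrow y -> x = y.
Proof.
move=> /hermE ex /hermE ey /rowP e; rewrite ex ey.
have e0 := e 0; have e1 := e 1; have e2 := e (inord 2); have e3 := e (inord 3).
by move: e0 e1 e2 e3; rewrite !mxE /= !inordK //= => -> -> -> ->.
Qed.

Lemma rcombE n (a : 'I_n -> R) (x : 'I_n -> M2) i j :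
  (clRe (rcomb a x i j) = \sum_k a k * clRe (x k i j)) *
  (clIm (rcomb a x i j) = \sum_k a k * clIm (x k i j)).
Proof.
rewrite /rcomb summxE; split; [rewrite (big_morph _ clReD clRe0)
  | rewrite (big_morph _ clImD clIm0)];
by apply: eq_bigr => k _; rewrite mxE !clE; ring.
Qed.

Lemma circ_rcomb n (a : 'I_n -> R) (x : 'I_n -> M2) :
  (forall i, circ (x i) = x i) -> circ (rcomb a x) = rcomb a x.
Proof.
move=> cx; rewrite /rcomb (big_morph _ circD (_ : circ 0 = 0)); last first.
  by have := circ_rscale 0 (0 : M2); rewrite !rscale0.
by apply: eq_bigr => k _; rewrite circ_rscale cx.
Qed.

Lemma hermrow_rcomb n (a : 'I_n -> R) (x : 'I_n -> M2) :
  hermrow (rcomb a x) = (\row_i a i) *m \matrix_i hermrow (x i).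
Proof.
apply/rowP=> j; rewrite !mxE; under eq_bigr do rewrite !mxE.
by case: j => [[|[|[|[|//]]]] /= _]; rewrite !rcombE.
Qed.

Lemma hermrow_free n (x : 'I_n -> M2) : (forall i, circ (x i) = x i) ->
  rfree x -> row_free (\matrix_i hermrow (x i)).
Proof.
move=> cx fx; apply: inj_row_free => a a0; apply/rowP=> i; rewrite mxE.
apply: (fx (fun i => a 0 i)); apply: hermrow_inj.
- exact: circ_rcomb.
- by have := circ_rscale 0 (0 : M2); rewrite !rscale0.
- rewrite hermrow_rcomb (_ : \row_i a 0 i = a) ?a0; last first.
    by apply/rowP=> j; rewrite mxE.
  apply/rowP=> j; rewrite !mxE clRe0 clIm0.
  by case: j => [[|[|[|[|//]]]] /= _].
Qed.

(** Coefficients of the linear form in [tr_aherm_herm]: diagonal parts count twice, and the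
    off-diagonal entries of [Z] trade places. *)
Definition ahermcol Z : 'cV[R]_4 := \col_i
  [:: 2 * clIm (Z 0 0); 2 * clRe (Z 0 0); clRe (Z 1 0); clRe (Z 0 1)]`_i.

Lemma tr_hermrow Z x : circ Z = - Z -> circ x = x ->
  \tr (Z *m x) = mkCL 0 ((hermrow x *m ahermcol Z) 0 0).
Proof.
move=> /ahermE eZ /hermE ex; rewrite [in LHS]eZ [in LHS]ex tr_aherm_herm.
rewrite mxE !big_ord_recl big_ord0 !mxE /= addr0.
by congr mkCL; ring.
Qed.

Lemma tr_rcomb n (a : 'I_n -> R) (x : 'I_n -> M2) Z :
  (forall i, \tr (Z *m x i) = 0) -> \tr (Z *m rcomb a x) = 0.
Proof.
move=> h; rewrite /rcomb mulmx_sumr raddf_sum big1 //= => i _.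
by rewrite rscalerr /rscale linearZ /= h mulr0.
Qed.

Lemma plane_normal (W : set M2) : isPlane W -> exists Z,
  [/\ circ Z = - Z, Z != 0 & forall x, W x <-> circ x = x /\ \tr (Z *m x) = 0].
Proof.
case=> w [cw fw ->]; set M := \matrix_i hermrow (w i).
have rM : \rank M = 3 by apply/eqP: (hermrow_free cw fw).
(* [M] has rank 3 and four columns, so some nonzero [v] is orthogonal to all its rows. *)
have /rowV0Pn[v /sub_kermxP vM v0] : kermx M^T != 0.
  by rewrite -mxrank_eq0 mxrank_ker mxrank_tr rM.
(* The entries undo the factors 2 and the swap in [ahermcol]. *)
pose Z : M2 := aherm (v 0 0 / 2) (v 0 1 / 2) (v 0 (inord 3)) (v 0 (inord 2)).
have cZ : circ Z = - Z by exact: circ_aherm.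
have colZ : ahermcol Z = v^T.
  apply/colP=> j; rewrite !mxE /= !clE.
  case: j => [[|[|[|[|//]]]] /= lt4];
    rewrite ?[2 * (_ / 2)]mulrC ?divfK ?pnatr_eq0 //; congr (v _ _);
    by apply: val_inj; rewrite /= ?inordK.
have Mv : M *m v^T = 0 by rewrite -[M]trmxK -trmx_mul vM trmx0.
exists Z; split=> //.
  apply/eqP=> Z0; move/eqP: v0; apply; apply: trmx_inj; rewrite -colZ Z0.
  apply/colP=> j; rewrite !mxE clRe0 clIm0 mulr0.
  by case: j => [[|[|[|[|//]]]] /= _].
move=> x; split=> [[a ->]|[cx]].
  split; first exact: circ_rcomb.
  apply: tr_rcomb => i; rewrite tr_hermrow // colZ.
  have -> : hermrow (w i) = row i M by rewrite rowK.
  by rewrite -row_mul Mv row0 mxE /mkCL !scale0r addr0.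
rewrite tr_hermrow // colZ => /(congr1 clIm); rewrite !clE => xv.
(* The row space of [M] lies in the annihilator of [v], and both have dimension 3. *)
have /submxP[a ea] : (hermrow x <= M)%MS.
  apply: (@submx_trans _ _ _ _ _ _ (kermx v^T)).
    by apply/sub_kermxP/matrixP=> i j; rewrite !ord1 xv mxE.
  rewrite -(mxrank_leqif_sup (_ : M <= kermx v^T)%MS); last exact/sub_kermxP.
  by rewrite rM mxrank_ker mxrank_tr rank_rV v0.
exists (fun i => a 0 i); apply: hermrow_inj => //; first exact: circ_rcomb.
by rewrite hermrow_rcomb ea; congr (_ *m _); apply/rowP=> j; rewrite mxE.
Qed.

(** The trace pairing is nondegenerate: in coordinates, an invertible 4 by 4 matrix kills
    [ahermcol Z]. *)
Lemma normal_basis_eq0 (v : 'I_4 -> M2) Z : (forall i, circ (v i) = v i) ->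
  rfree v -> circ Z = - Z -> (forall i, \tr (Z *m v i) = 0) -> Z = 0.
Proof.
move=> cv fv cZ tZ.
have: row_free (\matrix_i hermrow (v i)) by exact: hermrow_free.
rewrite row_free_unit => uM.
have: (\matrix_i hermrow (v i)) *m ahermcol Z = 0.
  apply/row_matrixP=> i; rewrite row_mul rowK row0; apply/matrixP=> j k.
  have := tZ i; rewrite tr_hermrow // !ord1 mxE => /(congr1 clIm).
  by rewrite !clE mxE.
move=> /(canRL (mulKmx uM)) e.
have {e}/colP e : ahermcol Z = 0 by rewrite e mulmx0.
have e0 := e 0; have e1 := e 1; have e2 := e (inord 2); have e3 := e (inord 3).
rewrite (ahermE cZ); move: e0 e1 e2 e3.
rewrite !mxE /= !inordK //= => e0 e1 -> ->.
have -> : clRe (Z 0 0) = 0 by lra.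
have -> : clIm (Z 0 0) = 0 by lra.
by rewrite -[RHS]mx2_0 /aherm oppr0 /mkCL !scale0r addr0.
Qed.

End RealSpan.

Section Exponential.
Context {R : realType} {Lam : int}.
Local Notation C := (CL R Lam).
Local Notation M2 := 'M[C]_2.
Implicit Types (X : M2) (k : R).

(** If [X] squares to the real scalar [k], its exponential splits into even and odd powers; for
    positive [k] the two series sum to $\cosh\sqrt k$ and $\sinh\sqrt k/\sqrt k$. *)
Definition even_coeff k (n : nat) : R :=
  if odd n then 0 else k ^+ n./2 / n`!%:R.
Definition odd_coeff k (n : nat) : R :=
  if odd n then k ^+ n./2 / n`!%:R else 0.

(** As [1 + |k|] is at least 1, the exponent [n./2] can be raised to [n], which gives one
    exponential majorant for both signs of [k]. *)
Lemma coeff_le_exp k n : `|k ^+ n./2 / n`!%:R| <= exp_coeff (1 + `|k|) n.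
Proof.
rewrite /exp_coeff /= normrM normrX (ger0_norm (_ : 0 <= _^-1)) ?invr_ge0 //.
rewrite ler_wpM2r ?invr_ge0 //.
have le1 : 1 <= 1 + `|k| by rewrite lerDl.
apply: (@le_trans _ _ ((1 + `|k|) ^+ n./2)).
  by rewrite lerXn2r ?nnegrE ?addr_ge0 // lerDr.
by rewrite ler_weXn2l // -[leqRHS]odd_double_half -addnn addnCA leq_addr.
Qed.

Lemma is_cvg_coeff k (u : R ^nat) :
  (forall n, `|u n| <= `|k ^+ n./2 / n`!%:R|) -> cvgn (series u).
Proof.
move=> hu; apply: normed_cvg.
apply: series_le_cvg (is_cvg_series_exp_coeff (1 + `|k|)) => n /=.
- exact: normr_ge0.
- by apply: exp_coeff_ge0; rewrite addr_ge0.
- exact: le_trans (hu n) (coeff_le_exp _ _).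
Qed.

Lemma is_cvg_even_coeff k : cvgn (series (even_coeff k)).
Proof.
apply: (@is_cvg_coeff k) => n; rewrite /even_coeff.
by case: odd => //; rewrite normr0.
Qed.

Lemma is_cvg_odd_coeff k : cvgn (series (odd_coeff k)).
Proof.
apply: (@is_cvg_coeff k) => n; rewrite /odd_coeff.
by case: odd => //; rewrite normr0.
Qed.

Lemma sqr_scalar_exp k X n : X *m X = rscale k 1%:M ->
  X ^+ n = rscale (k ^+ n./2) (if odd n then X else 1%:M).
Proof.
move=> sX; elim: n => [|n IHn]; first by rewrite !expr0 rscale1.
rewrite exprS IHn -mulmxE rscalerr /= uphalf_half.
by case: odd; rewrite ?sX ?mulmx1 ?rscaleM ?add0n // add1n exprSr.
Qed.

Lemma expseriesE k X n : X *m X = rscale k 1%:M ->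
  expseries X n = rscale (series (even_coeff k) n) 1%:M +
                  rscale (series (odd_coeff k) n) X.
Proof.
move=> sX; rewrite /expseries /series /=.
elim: n => [|n IHn]; first by rewrite !big_geq // !rscale0 addr0.
rewrite !big_nat_recr //= IHn (sqr_scalar_exp _ sX) rscaleM.
rewrite /even_coeff /odd_coeff [n`!%:R^-1 * _]mulrC.
have rD (a b : R) (A : M2) : rscale (a + b) A = rscale a A + rscale b A.
  by rewrite /rscale scalerDl scalerDl.
by case: odd; rewrite ?addr0 rD; [rewrite addrA | rewrite addrAC].
Qed.

Lemma clE_entry (A B : M2) i j :
  (clRe ((A + B) i j) = clRe (A i j) + clRe (B i j)) *
  (clIm ((A + B) i j) = clIm (A i j) + clIm (B i j)).
Proof. by rewrite mxE !clE. Qed.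

Lemma rscale_entry k (A : M2) i j :
  (clRe (rscale k A i j) = k * clRe (A i j)) *
  (clIm (rscale k A i j) = k * clIm (A i j)).
Proof. by rewrite mxE !clE; split; ring. Qed.

(** The point is that [mexp X] is a real combination of 1 and [X], so a linear condition satisfied
    by both holds along the whole geodesic. *)
Lemma mexpE k X : X *m X = rscale k 1%:M ->
  mexp X = rscale (limn (series (even_coeff k))) 1%:M +
           rscale (limn (series (odd_coeff k))) X.
Proof.
move=> sX; apply/matrixP=> i j; rewrite [LHS]mxE.
have cvC : cvgn (series (even_coeff k)) by exact: is_cvg_even_coeff.
have cvS : cvgn (series (odd_coeff k)) by exact: is_cvg_odd_coeff.
apply: cl_eq; rewrite [RHS]clE_entry !rscale_entry ?clRe_mk ?clIm_mk;
  apply/cvg_lim => //.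
  under eq_fun do rewrite (expseriesE _ sX) clE_entry !rscale_entry.
  by apply: cvgD; apply: cvgMl.
under eq_fun do rewrite (expseriesE _ sX) clE_entry !rscale_entry.
by apply: cvgD; apply: cvgMl.
Qed.

Lemma mexp_sqr0 X : X *m X = 0 -> mexp X = 1%:M + X.
Proof.
move=> sX; rewrite (@mexpE 0) ?rscale0 //.
rewrite -[1%:M in RHS]rscale1 -[X in RHS]rscale1.
(* For [k = 0] only one term of each series survives, at index 0 or 1, because [0 ^+ 0 = 1]; from
   index 2 on the partial sums equal 1. *)
have lim1 (u : R ^nat) : (forall n, series u n.+2 = 1) -> limn (series u) = 1.
  move=> u1; apply/cvg_lim => //; rewrite -(cvg_shiftn 2).
  by under eq_fun do rewrite addn2 u1; apply: cvg_cst.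
congr (rscale _ _ + rscale _ _); apply: lim1 => n; rewrite /series /=.
  rewrite big_ltn // big1_seq ?addr0 /even_coeff /= ?divr1 // => i.
  rewrite mem_index_iota => /andP[i0 _]; case: ifP => // oi.
  by rewrite expr0n; case: i i0 oi => [|[|i]] //= _ _; rewrite mul0r.
rewrite 2?big_ltn // big1_seq /odd_coeff /= ?add0r ?addr0 ?divr1 // => i.
rewrite mem_index_iota => /andP[i0 _]; case: ifP => // oi.
by rewrite expr0n; case: i i0 oi => [|[|i]] //= _ _; rewrite mul0r.
Qed.

End Exponential.

(** * Normals of lightlike planes *)

Section LightlikePlanes.
Context {R : realType} {Lam : int}.
Local Notation C := (CL R Lam).
Local Notation M2 := 'M[C]_2.
Implicit Types (x A X Z : M2).

Lemma herm0 : herm 0 0 0 0 = 0 :> M2.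
Proof. by rewrite -(rscale0 (herm 0 0 0 0)) rscale_herm !mul0r. Qed.

Lemma tangentE X : inTangent X -> exists q r s : R, X = herm 0 q r s.
Proof.
case=> /hermE -> tX; move/(congr1 clRe): tX.
rewrite /herm mxE2 !clE => p0; set p := clRe _ in p0 *.
have -> : p = 0 by lra.
by exists (clIm (X 0 0)), (clIm (X 0 1)), (clIm (X 1 0)).
Qed.

Lemma tangent_herm (q r s : R) : inTangent (herm 0 q r s : M2).
Proof.
split; first exact: circ_herm.
by rewrite /herm mxE2; apply: cl_eq; rewrite !clE; ring.
Qed.

Lemma imdet_herm (q r s : R) : imdet (herm 0 q r s : M2) = - (q ^+ 2 + r * s).
Proof.
rewrite /imdet (_ : map_mx _ _ = mx2 q r s (- q)) ?mx2_det; first by ring.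
by rewrite [LHS]mx2_eta !mxE /= !clE.
Qed.

Lemma sqr_herm (q r s : R) : (herm 0 q r s : M2) *m herm 0 q r s =
  rscale (- Lam%:~R * (q ^+ 2 + r * s)) 1%:M.
Proof.
rewrite -mx2_1 /herm !mxE2.
by congr mx2; apply: cl_eq; rewrite !clE; ring.
Qed.

Lemma circ_aherm_congr A Z : circ Z = - Z ->
  circ (circ A *m Z *m A) = - (circ A *m Z *m A).
Proof. by move=> cZ; rewrite !circM circK cZ mulNmx mulmxN !mulmxA. Qed.

Lemma tr_act A Z x : \tr (Z *m act A x) = \tr (circ A *m Z *m A *m x).
Proof. by rewrite /act mulmxA mxtrace_mulC !mulmxA. Qed.

Lemma det_congr A Z :
  \det (circ A *m Z *m A) = (clnormsq (\det A))%:A * \det Z.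
Proof. by rewrite !det_mulmx det_circ -mul_conj; ring. Qed.

(* Here (k, l, n) stands for [[k, l], [n, -k]] in sl(2, R) with the form - det,
   whose polar form is half of [2 k q + l s + n r]. *)
Lemma null_orthogonal_timelike (k l n q r s : R) :
  2 * k * q + l * s + n * r = 0 -> q ^+ 2 + r * s = 0 -> k ^+ 2 + l * n < 0 ->
  [/\ q = 0, r = 0 & s = 0].
Proof.
move=> o nul tl.
(* The left side is a square and the right side is nonpositive, which forces [q = 0]. *)
have e : (l * s - n * r) ^+ 2 = 4 * q ^+ 2 * (k ^+ 2 + l * n).
  have -> : (l * s - n * r) ^+ 2 = (l * s + n * r) ^+ 2 - 4 * (l * n) * (r * s).
    by ring.
  have -> : l * s + n * r = - (2 * k * q) by lra.
  have -> : r * s = - q ^+ 2 by lra.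
  by ring.
have q0 : q = 0.
  apply/eqP; rewrite -sqrf_eq0 eq_le sqr_ge0 andbT.
  have := sqr_ge0 (l * s - n * r); rewrite e.
  by rewrite -mulrA pmulr_rge0 // nmulr_lge0.
have /eqP : (l * s - n * r) ^+ 2 = 0 by rewrite e q0; ring.
rewrite sqrf_eq0 => /eqP d; move: o; rewrite q0 mulr0 add0r => o.
have ls : l * s = 0 by lra.
have nr : n * r = 0 by lra.
have ln : l * n < 0 by have := sqr_ge0 k; lra.
have l0 : l != 0 by apply: contraTneq ln => ->; rewrite mul0r ltxx.
have n0 : n != 0 by apply: contraTneq ln => ->; rewrite mulr0 ltxx.
split=> //; apply/eqP.
  by move/eqP: nr; rewrite mulf_eq0 (negbTE n0).
by move/eqP: ls; rewrite mulf_eq0 (negbTE l0).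
Qed.

(* The projection of the timelike matrix [[0, 1], [-1, 0]] to the orthogonal
   complement of the spacelike matrix [[k, l], [n, -k]]. *)
Lemma spacelike_orthogonal_timelike (k l n : R) : 0 < k ^+ 2 + l * n ->
  exists q r s, 2 * k * q + l * s + n * r = 0 /\ q ^+ 2 + r * s < 0.
Proof.
set m := k ^+ 2 + l * n => m0; pose j := (n - l) / 2.
exists (- j * k), (m - j * l), (- m - j * n); split.
  by rewrite /m /j; field.
have -> : (- j * k) ^+ 2 + (m - j * l) * (- m - j * n) = - (m * (m + j ^+ 2)).
  by rewrite /m /j; field.
by rewrite oppr_lt0 mulr_gt0 // ltr_wpDr // sqr_ge0.
Qed.

(** Pulled back along [A], the plane contains 1, so its normal is a real traceless matrix K. K is
    not timelike, since the nonzero null vector [X] is orthogonal to it, and not spacelike, since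
    the plane would then contain a timelike geodesic. *)
Lemma lightlike_normal (W : set M2) Z : circ Z = - Z ->
  (forall x, W x <-> circ x = x /\ \tr (Z *m x) = 0) ->
  lightlike_plane W -> \det Z = 0.
Proof.
move=> cZ defW [_ [A [X [[pA tX X0] lX cX]] noT]].
have cZ' := circ_aherm_congr A cZ.
have trW x : W (act A x) -> \tr (circ A *m Z *m A *m x) = 0.
  by case/defW=> _; rewrite tr_act.
move: (ahermE cZ') (det_congr A Z) trW; set Z' := circ A *m Z *m A.
set u := clIm _; set k := clRe (Z' 0 0); set l := clRe _; set n := clRe _.
move=> eZ' dZ' trW.
have [q [r [s eX]]] := tangentE tX.
have nul : q ^+ 2 + r * s = 0.
  by move: lX; rewrite /lightlike eX imdet_herm opprK.
(* Hence the geodesic through 1 is the straight line [1 + t X]; times 0 and 1 give the two linear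
   conditions on the normal. *)
have X2 : X *m X = 0 by rewrite eX sqr_herm nul mulr0 rscale0.
have tr1 : \tr (Z' *m 1%:M) = 0.
  apply: trW; have := cX 0.
  by rewrite /geodesic rscale0 mexp_sqr0 ?mul0mx // addr0.
have u0 : u = 0.
  move: tr1; rewrite -herm1 eZ' tr_aherm_herm => /(congr1 clIm).
  by rewrite !clE; lra.
have trX : \tr (Z' *m X) = 0.
  have := trW (1%:M + X); rewrite mulmxDr linearD /= tr1 add0r; apply.
  by have := cX 1; rewrite /geodesic rscale1 mexp_sqr0.
have o : 2 * k * q + l * s + n * r = 0.
  move: trX; rewrite eX eZ' tr_aherm_herm => /(congr1 clIm).
  by rewrite !clE u0; lra.
have nulZ : k ^+ 2 + l * n = 0.
  have [tl|sl|//] := ltrgtP (k ^+ 2 + l * n) 0.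
    have [q0 r0 s0] := null_orthogonal_timelike o nul tl.
    by case/eqP: X0; rewrite eX q0 r0 s0 herm0.
  case: noT; have [q' [r' [s' [oK tlK]]]] := spacelike_orthogonal_timelike sl.
  exists A, (herm 0 q' r' s'); split.
  - split=> //; first exact: tangent_herm.
    apply/eqP=> h0; have := imdet_herm q' r' s'.
    rewrite h0 /imdet => e; move: tlK.
    have -> : q' ^+ 2 + r' * s' = 0.
      apply: oppr_inj; rewrite -e oppr0 (_ : map_mx _ _ = 0) ?det0 //.
      by apply/matrixP=> i j; rewrite !mxE clIm0.
    by rewrite ltxx.
  - by rewrite /timelike imdet_herm opprK.
  move=> t; rewrite /geodesic rscale_herm mulr0 (mexpE (sqr_herm _ _ _)).
  (* Both 1 and the tangent vector are orthogonal to [Z'], so the argument works for any values of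
     [a] and [b]. *)
  set a := limn _; set b := limn _; rewrite -herm1 !rscale_herm !mulr0.
  apply/defW; split.
    by apply: circ_act; rewrite circD !circ_herm.
  rewrite tr_act -/Z' eZ' mulmxDr linearD /= !tr_aherm_herm.
  apply: cl_eq; rewrite !clE ?addr0 // u0.
  transitivity (b * t * (2 * k * q' + l * s' + n * r')); first by ring.
  by rewrite oK mulr0.
apply: (mulrI (alg_unit (lt0r_neq0 pA))); rewrite -dZ' eZ' det_aherm u0 mulr0.
by rewrite -addrA nulZ; apply: cl_eq; rewrite !clE; ring.
Qed.

End LightlikePlanes.

(** * The four null normals of a lightlike tetrahedron *)

Section Normalization.
Context {R : realType} {Lam : int}.
Local Notation C := (CL R Lam).
Local Notation M2 := 'M[C]_2.
Implicit Types (x A B X : M2).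

Lemma rscale_inj (r : R) x y : r != 0 -> rscale r x = rscale r y -> x = y.
Proof.
move=> r0 e; rewrite -[x]rscale1 -[y]rscale1 -(mulVf r0) -!rscaleM.
by rewrite e.
Qed.

(* If det x = l ^ 2, Cayley-Hamilton gives (x + l) ^ 2 = (tr x + 2 l) x. *)
Lemma act_to_one x : inX x -> exists A,
  inPGLplus A /\ exists2 r : R, r != 0 & act A x = rscale r 1%:M.
Proof.
(* Changing the sign of the representative reduces to [0 <= p], which makes [p + l] positive
   below. *)
suff pos p q r s : inX (herm p q r s : M2) -> 0 <= p -> exists A : M2,
    inPGLplus A /\ exists2 a : R, a != 0 & act A (herm p q r s) = rscale a 1%:M.
  move=> hx; have [cx dx] := hx; move: hx; rewrite (hermE cx).
  set p := clRe _; set q := clIm _; set r := clIm _; set s := clIm _ => hx.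
  have [p0|p0] := leP 0 p; first exact: pos.
  have [||A [pA [a a0 e]]] := pos (- p) (- q) (- r) (- s).
  - split; first exact: circ_herm.
    by have := hx.2; rewrite !det_herm !clRe_alg; nra.
  - by rewrite oppr_ge0 ltW.
  exists A; split=> //; exists (- a); first by rewrite oppr_eq0.
  apply: (@rscale_inj (-1)); first by rewrite oppr_eq0 oner_eq0.
  by rewrite -act_rscale rscale_herm !mulN1r rscaleM mulN1r opprK.
move=> [_]; rewrite det_herm clRe_alg; set D := _ + _ => D0 p0.
pose l := Num.sqrt D; have l0 : 0 < l by rewrite sqrtr_gt0.
have l2 : l ^+ 2 = D by rewrite sqr_sqrtr // ltW.
pose y : M2 := herm (p + l) q r s.
have dy : \det y = (2 * l * (p + l))%:A.
  by rewrite det_herm; congr (_%:A); move: l2; rewrite /D; lra.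
have py : inPGLplus y.
  by rewrite /inPGLplus dy clnormsq_alg exprn_gt0 // !mulr_gt0 // ltr_wpDl.
have pl : p + l != 0 by rewrite lt0r_neq0 // ltr_wpDl.
(* As [circ y = y], the image of 1 under [y] is the square of [y], a multiple of the given point;
   [\adj y] carries it back. *)
have sy : act y 1%:M = rscale (2 * (p + l)) (herm p q r s).
  rewrite /act mulmx1 circ_herm /herm !mxE2.
  by congr mx2; apply: cl_eq; rewrite !clE; move: l2; rewrite /D; lra.
exists (\adj y); split; first exact: inPGLplus_adj.
exists (clnormsq (\det y) / (2 * (p + l))).
  by rewrite mulf_neq0 ?invr_eq0 ?mulf_neq0 ?pnatr_eq0 // lt0r_neq0.
apply: (@rscale_inj (2 * (p + l))); first by rewrite mulf_neq0 ?pnatr_eq0.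
rewrite rscaleM [_ * (_ / _)]mulrC divfK; last by rewrite mulf_neq0 ?pnatr_eq0.
by rewrite -act_rscale -sy act_adj.
Qed.

(* [Z i] is the normal of the face opposite to the vertex [v i]. *)
Record null_frame (v Z : 'I_4 -> M2) : Prop := NullFrame {
  nf_inX : forall i, inX (v i);
  nf_circ : forall i, circ (Z i) = - Z i;
  nf_det : forall i, \det (Z i) = 0;
  nf_orth : forall i j, i != j -> \tr (Z i *m v j) = 0;
  nf_dual : forall i, \tr (Z i *m v i) != 0 }.

Lemma rcomb_delta (v : 'I_4 -> M2) j : rcomb (fun i => (i == j)%:R) v = v j.
Proof.
rewrite /rcomb (bigD1 j) //= eqxx rscale1 big1 ?addr0 // => i /negbTE ->.
exact: rscale0.
Qed.

Lemma sum_delta (j : 'I_4) : \sum_i (i == j)%:R != 0 :> R.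
Proof.
rewrite (bigD1 j) //= eqxx big1 ?addr0 ?oner_eq0 // => i /negbTE ->.
by [].
Qed.

(** The plane of face [i] contains the other three vertices; a normal orthogonal to [v i] as well
    would be orthogonal to a basis, hence zero. *)
Lemma tetrahedron_null_frame (v : 'I_4 -> M2) :
  lightlike_tetrahedron v -> exists Z, null_frame v Z.
Proof.
case=> -[cv fv Xv] faces _.
have normal i : exists Z, [/\ circ Z = - Z, \det Z = 0,
    \tr (Z *m v i) != 0 & forall j, i != j -> \tr (Z *m v j) = 0].
  have [W lW fW] := faces i; have [pW _ _] := lW.
  have [Z [cZ Z0 defW]] := plane_normal pW.
  have oZ j : i != j -> \tr (Z *m v j) = 0.
    move=> ij; suff /defW[] : W (v j) by [].
    apply: fW; exists (fun i => (i == j)%:R); split=> //.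
    - by rewrite (negbTE ij).
    - exact: sum_delta.
    - by exists 1; rewrite ?oner_eq0 // rscale1 rcomb_delta.
  exists Z; split=> //; first exact: lightlike_normal lW.
  apply: contra_neq Z0 => Zi; apply: (normal_basis_eq0 cv fv cZ) => j.
  by have [<-|/oZ] := eqVneq i j.
have [Z hZ] := choice normal.
exists Z; split=> [i|i|i|i j ij|i].
- by rewrite -rcomb_delta; apply: Xv => //; exact: sum_delta.
- by case: (hZ i).
- by case: (hZ i).
- by case: (hZ i) => _ _ _; apply.
- by case: (hZ i).
Qed.

Lemma act_mul_adj B x : act B (act (\adj B) x) = rscale (clnormsq (\det B)) x.
Proof. by rewrite -actM mul_mx_adj -scalemx1 act_scale act1. Qed.

(** Normals are pulled back along the inverse of the map that moves the points, hence [\adj B] on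
    vertices and [B] on normals. *)
Lemma null_frame_act B v Z : inPGLplus B -> null_frame v Z ->
  null_frame (fun i => act (\adj B) (v i)) (fun i => circ B *m Z i *m B).
Proof.
move=> pB [vX cZ dZ oZ nZ].
have tZ i j : \tr (circ B *m Z i *m B *m act (\adj B) (v j)) =
    (clnormsq (\det B))%:A * \tr (Z i *m v j).
  by rewrite -tr_act act_mul_adj rscalerr /rscale linearZ.
split=> [i|i|i|i j ij|i]; rewrite ?tZ.
- case: (vX i) => cv dv; split; first exact: circ_act.
  by rewrite det_act !clE mul0r mulr0 subr0 mulr_gt0 //; apply: inPGLplus_adj.
- exact: circ_aherm_congr.
- by rewrite det_congr dZ mulr0.
- by rewrite oZ ?mulr0.
- by rewrite (mulrI_eq0 _ (mulrI (alg_unit (lt0r_neq0 pB)))).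
Qed.

End Normalization.

(** * Three normals as points of the real projective line *)

Section StandardPosition.
Context {R : realType} {Lam : int}.
Local Notation C := (CL R Lam).
Local Notation M2 := 'M[C]_2.
Implicit Types (A B : M2).

Lemma inord4_neq (i j : nat) : (i < 4)%N -> (j < 4)%N -> i != j ->
  inord i != inord j :> 'I_4.
Proof. by move=> i4 j4; rewrite -val_eqE /= !inordK. Qed.

(* [c (x, y)^T (y, -x)], the nilpotent real matrix with kernel (x, y). *)
Definition nilp (c x y : R) : M2 :=
  aherm 0 (c * x * y) (- c * x ^+ 2) (c * y ^+ 2).

Definition realmx (a b c d : R) : M2 := mx2 a%:A b%:A c%:A d%:A.

Lemma aherm_nilp (k l n : R) : k ^+ 2 + l * n = 0 ->
  exists c x y : R, aherm 0 k l n = nilp c x y.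
Proof.
move=> nul; have [l0|l0] := eqVneq l 0.
  exists n, 0, 1; rewrite /nilp l0; move: nul.
  rewrite l0 mul0r addr0 => /eqP; rewrite sqrf_eq0 => /eqP ->.
  by congr aherm; ring.
(* The vector [(l, - k)] spans the kernel, and the upper right entry [l = - c * l ^+ 2] fixes
   [c]. *)
exists (- l^-1), l, (- k); rewrite /nilp; have -> : n = - k ^+ 2 / l.
  by apply: (mulfI l0); rewrite mulrCA divff // mulr1; lra.
by congr aherm; field.
Qed.

(** On real matrices [circ] is the adjugate, so the kernel [(x, y)] moves by the adjugate, that is,
    by the inverse up to scale. *)
Lemma congr_nilp (a b c d e x y : R) :
  circ (realmx a b c d) *m nilp e x y *m realmx a b c d =
  nilp e (d * x - b * y) (a * y - c * x).
Proof.
rewrite /realmx /nilp /aherm mx2_circ !mxE2.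
by congr mx2; apply: cl_eq; rewrite !clE; ring.
Qed.

Lemma mx2_adj (a b c d : C) : \adj (mx2 a b c d) = mx2 d (- b) (- c) a.
Proof.
rewrite [LHS]mx2_eta !mxE /cofactor !det_mx11 !mxE /=.
by congr mx2; rewrite /bump /= ?expr0 ?expr1 ?sqrrN ?expr1n; ring.
Qed.

(** Invertible real matrices fix the point 1; they are the freedom left once the fourth vertex is
    placed there. *)
Lemma act_adj_realmx1 (a b c d : R) :
  act (\adj (realmx a b c d)) 1%:M = rscale (a * d - b * c) 1%:M.
Proof.
rewrite /act mulmx1 -mx2_1 mx2_adj !mxE2.
by congr mx2; apply: cl_eq; rewrite !clE; ring.
Qed.

Lemma inPGLplus_realmx (a b c d : R) :
  a * d - b * c != 0 -> inPGLplus (realmx a b c d).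
Proof.
move=> nz; rewrite /inPGLplus (_ : \det _ = (a * d - b * c)%:A).
  by rewrite clnormsq_alg exprn_even_gt0.
by rewrite /realmx mxE2; apply: cl_eq; rewrite !clE; ring.
Qed.

Lemma aherm0 : aherm 0 0 0 0 = 0 :> M2.
Proof. by rewrite -(rscale0 (aherm 0 0 0 0)) rscale_aherm !mul0r. Qed.

(** The matrix [nilp c x y] is quadratic in [(x, y)], so parallel kernels make the traces
    proportional. Cross-multiplying avoids division by a coordinate that may vanish. *)
Lemma tr_nilp_eq0 (e x y f z t : R) (w : M2) : circ w = w ->
  x * t = y * z -> \tr (nilp e x y *m w) != 0 ->
  \tr (nilp f z t *m w) = 0 -> nilp f z t = 0.
Proof.
move=> /hermE ->; rewrite /nilp !tr_aherm_herm.
set p := clRe _; set q := clIm _; set s := clIm _; set r := clIm _ => par.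
set Q := 2 * 0 * _ + _ + _ + _ => Q0; set P := 2 * 0 * _ + _ + _ + _ => P0.
have {}P0 : P = 0 by move/(congr1 clIm): P0; rewrite !clE.
have {}Q0 : Q != 0.
  by apply: contra_neq Q0 => ->; apply: cl_eq; rewrite !clE.
have zQ : f * z ^+ 2 * Q = 0.
  transitivity (e * x ^+ 2 * P); last by rewrite P0 mulr0.
  rewrite /Q /P.
  apply/eqP; rewrite -subr_eq0; apply/eqP.
  transitivity ((x * t - y * z) *
      (- 2 * e * f * q * x * z - e * f * r * (x * t + y * z))).
    by ring.
  by rewrite par subrr mul0r.
have tQ : f * t ^+ 2 * Q = 0.
  transitivity (e * y ^+ 2 * P); last by rewrite P0 mulr0.
  rewrite /Q /P.
  apply/eqP; rewrite -subr_eq0; apply/eqP.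
  transitivity ((x * t - y * z) *
      (2 * e * f * q * y * t - e * f * s * (x * t + y * z))).
    by ring.
  by rewrite par subrr mul0r.
move/eqP: zQ; rewrite mulf_eq0 (negbTE Q0) orbF => /eqP zQ.
move/eqP: tQ; rewrite mulf_eq0 (negbTE Q0) orbF => /eqP tQ.
have fzt : f * z * t = 0.
  apply/eqP; rewrite -sqrf_eq0; apply/eqP.
  by transitivity ((f * z ^+ 2) * (f * t ^+ 2)); [ring | rewrite zQ mul0r].
by rewrite fzt mulNr zQ tQ oppr0 aherm0.
Qed.

Lemma mx2_adjK A : \adj (\adj A) = A.
Proof. by rewrite [A]mx2_eta !mx2_adj !opprK. Qed.

(* The kernels of Z 0, Z 1, Z 2 are three points of the real projective line,
   which B^-1 moves to (0, 1), (1, 0) and (1, 1). *)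
Lemma standard_null_frame (v Z : 'I_4 -> M2) (r : R) :
  null_frame v Z -> r != 0 -> v (inord 3) = rscale r 1%:M ->
  exists A Z', [/\ inPGLplus A, null_frame (fun i => act A (v i)) Z',
    exists2 r' : R, r' != 0 & act A (v (inord 3)) = rscale r' 1%:M &
    exists m0 m1 m2 : R, [/\ Z' (inord 0) = aherm 0 0 0 m0,
      Z' (inord 1) = aherm 0 0 m1 0 & Z' (inord 2) = aherm 0 m2 (- m2) m2]].
Proof.
move=> nf r0 v3; have [vX cZ dZ oZ nZ] := nf.
have nilpZ i : i != inord 3 -> exists c x y, Z i = nilp c x y.
  move=> i3; move: (ahermE (cZ i)) (dZ i) (oZ i (inord 3) i3).
  move: (clIm _) (clRe _) (clRe _) (clRe _) => u k l n ->.
  rewrite v3 -herm1 rscale_herm tr_aherm_herm !mulr0 !addr0 det_aherm.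
  move=> /(congr1 clRe) + /(congr1 clIm); rewrite !clE mulr1 => nul /eqP.
  rewrite mulf_eq0 (negbTE r0) orbF mulf_eq0 pnatr_eq0 /= => /eqP u0.
  by rewrite u0; apply: aherm_nilp; rewrite u0 in nul; lra.
have [c0 [x0 [y0 Z0]]] := nilpZ (inord 0) (@inord4_neq 0 3 isT isT isT).
have [c1 [x1 [y1 Z1]]] := nilpZ (inord 1) (@inord4_neq 1 3 isT isT isT).
have [c2 [x2 [y2 Z2]]] := nilpZ (inord 2) (@inord4_neq 2 3 isT isT isT).
(* [v i] pairs nontrivially with [Z i] and trivially with [Z j], so parallel kernels would give
   [Z j = 0], against [nf_dual]. *)
have indep i j c x y c' x' y' : i != j -> Z i = nilp c x y ->
    Z j = nilp c' x' y' -> x * y' - y * x' != 0.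
  move=> ij Zi Zj; apply/eqP=> par.
  have [cv _] := vX i; have nzj := nZ j; move: nzj.
  rewrite Zj (@tr_nilp_eq0 c x y c' x' y' (v i)) ?mul0mx ?linear0 ?eqxx //.
  - by move: par; lra.
  - by rewrite -Zi nZ.
  - by rewrite -Zj oZ // eq_sym.
have d10 := indep _ _ _ _ _ _ _ _ (@inord4_neq 1 0 isT isT isT) Z1 Z0.
have d20 := indep _ _ _ _ _ _ _ _ (@inord4_neq 2 0 isT isT isT) Z2 Z0.
have d12 := indep _ _ _ _ _ _ _ _ (@inord4_neq 1 2 isT isT isT) Z1 Z2.
set d := x1 * y0 - y1 * x0 in d10; set la := x2 * y0 - y2 * x0 in d20.
set mu := x1 * y2 - y1 * x2 in d12.
(* By Cramer's rule [la * (x1, y1) + mu * (x0, y0) = d * (x2, y2)]; with these column weights [B]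
   sends (1, 1) into the kernel of [Z 2]. *)
pose B := realmx (la * x1) (mu * x0) (la * y1) (mu * y0).
have dB : la * x1 * (mu * y0) - mu * x0 * (la * y1) = la * mu * d.
  by rewrite /d; ring.
have dB0 : la * mu * d != 0 by rewrite !mulf_neq0.
have pB : inPGLplus B by apply: inPGLplus_realmx; rewrite dB.
exists (\adj B), (fun i => circ B *m Z i *m B); split.
- exact: inPGLplus_adj.
- exact: null_frame_act.
- exists (r * (la * mu * d)); first by rewrite mulf_neq0.
  by rewrite v3 act_rscale act_adj_realmx1 dB rscaleM.
exists (c0 * (la * d) ^+ 2), (- c1 * (mu * d) ^+ 2), (c2 * (la * mu) ^+ 2).
rewrite Z0 Z1 Z2 !congr_nilp /nilp; split; congr aherm;
  by rewrite /d /la /mu; ring.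
Qed.

(** Each of the first three vertices is orthogonal to two of the standard normals, which leaves it
    two parameters; the final relation is the vanishing of the determinant of the fourth normal. *)
Lemma standard_coordinates (v Z : 'I_4 -> M2) (r m0 m1 m2 : R) :
  null_frame v Z -> v (inord 3) = rscale r 1%:M ->
  Z (inord 0) = aherm 0 0 0 m0 -> Z (inord 1) = aherm 0 0 m1 0 ->
  Z (inord 2) = aherm 0 m2 (- m2) m2 ->
  exists p0 t0 p1 t1 p2 t2 : R,
   [/\ [/\ v (inord 0) = herm p0 t0 (- (2 * t0)) 0,
           v (inord 1) = herm p1 t1 0 (2 * t1)
         & v (inord 2) = herm p2 (- t2) 0 0],
       [/\ t0 != 0, t1 != 0 & t2 != 0],
       [/\ 0 < p0 ^+ 2 + Lam%:~R * t0 ^+ 2, 0 < p1 ^+ 2 + Lam%:~R * t1 ^+ 2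
         & 0 < p2 ^+ 2 + Lam%:~R * t2 ^+ 2]
     & p0 * p1 * t2 + p0 * t1 * p2 + t0 * p1 * p2 = Lam%:~R * (t0 * t1 * t2)].
Proof.
move=> [vX cZ dZ oZ nZ] v3 Z0 Z1 Z2.
have nzP (x : R) : mkCL 0 x != 0 :> C -> x != 0.
  by apply: contra_neq => ->; apply: cl_eq; rewrite !clE.
have zP (x : R) : mkCL 0 x = 0 :> C -> x = 0.
  by move/(congr1 clIm); rewrite !clE.
have coord i : exists p q r s : R,
    v i = herm p q r s /\ 0 < p ^+ 2 + Lam%:~R * (q ^+ 2 + r * s).
  have [cv dv] := vX i; move: dv; rewrite (hermE cv) det_herm clRe_alg => dv.
  by do 4 eexists; split; [reflexivity | exact: dv].
have [p0 [q0 [r0 [s0 [v0 D0]]]]] := coord (inord 0).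
have [p1 [q1 [r1 [s1 [v1 D1]]]]] := coord (inord 1).
have [p2 [q2 [r2 [s2 [v2 D2]]]]] := coord (inord 2).
have trz a b u k l n p q r' s' : (a < 4)%N -> (b < 4)%N -> a != b ->
    Z (inord a) = aherm u k l n -> v (inord b) = herm p q r' s' ->
    2 * u * p + 2 * k * q + l * s' + n * r' = 0.
  move=> a4 b4 ab Za vb; apply: zP.
  by rewrite -tr_aherm_herm -Za -vb oZ // inord4_neq.
have trn a u k l n p q r' s' :
    Z (inord a) = aherm u k l n -> v (inord a) = herm p q r' s' ->
    2 * u * p + 2 * k * q + l * s' + n * r' != 0.
  by move=> Za va; apply: nzP; rewrite -tr_aherm_herm -Za -va nZ.
have := ahermE (cZ (inord 3)).
set u := clIm _; set k := clRe _; set l := clRe (_ 0 1); set n := clRe _ => Z3.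
have n00 := trn 0 _ _ _ _ _ _ _ _ Z0 v0.
have n11 := trn 1 _ _ _ _ _ _ _ _ Z1 v1.
have n22 := trn 2 _ _ _ _ _ _ _ _ Z2 v2.
have n33 : 2 * u * r != 0.
  have v3' : v (inord 3) = herm r 0 0 0.
    by rewrite v3 -herm1 rscale_herm mulr1 !mulr0.
  by have := trn 3 _ _ _ _ _ _ _ _ Z3 v3'; rewrite !mulr0 !addr0.
have o01 := trz 0 1 _ _ _ _ _ _ _ _ isT isT isT Z0 v1.
have o02 := trz 0 2 _ _ _ _ _ _ _ _ isT isT isT Z0 v2.
have o10 := trz 1 0 _ _ _ _ _ _ _ _ isT isT isT Z1 v0.
have o12 := trz 1 2 _ _ _ _ _ _ _ _ isT isT isT Z1 v2.
have o20 := trz 2 0 _ _ _ _ _ _ _ _ isT isT isT Z2 v0.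
have o21 := trz 2 1 _ _ _ _ _ _ _ _ isT isT isT Z2 v1.
have o30 := trz 3 0 _ _ _ _ _ _ _ _ isT isT isT Z3 v0.
have o31 := trz 3 1 _ _ _ _ _ _ _ _ isT isT isT Z3 v1.
have o32 := trz 3 2 _ _ _ _ _ _ _ _ isT isT isT Z3 v2.
have : Lam%:~R * u ^+ 2 + k ^+ 2 + l * n = 0.
  have := dZ (inord 3); rewrite Z3 det_aherm => /(congr1 clRe).
  by rewrite !clE => /eqP; rewrite oppr_eq0 => /eqP.
move=> null.
have cancel (a b : R) : a != 0 -> a * b = 0 -> b = 0.
  by move=> a0 /eqP; rewrite mulf_eq0 (negbTE a0) => /eqP.
have m00 : m0 != 0 by apply: contra_neq n00 => ->; ring.
have m10 : m1 != 0 by apply: contra_neq n11 => ->; ring.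
have m20 : m2 != 0 by apply: contra_neq n22 => ->; ring.
(* The fourth vertex is off the opposite face, so the real multiple [u] can be divided out. *)
have u0 : u != 0 by apply: contra_neq n33 => ->; ring.
have r1z : r1 = 0 by apply: (cancel m0) => //; lra.
have r2z : r2 = 0 by apply: (cancel m0) => //; lra.
have s0z : s0 = 0 by apply: (cancel m1) => //; lra.
have s2z : s2 = 0 by apply: (cancel m1) => //; lra.
have r0E : r0 = - (2 * q0).
  suff: 2 * q0 - s0 + r0 = 0 by rewrite s0z; lra.
  by apply: (cancel m2) => //; lra.
have s1E : s1 = 2 * q1.
  suff: 2 * q1 - s1 + r1 = 0 by rewrite r1z; lra.
  by apply: (cancel m2) => //; lra.
have q00 : q0 != 0 by apply: contra_neq n00 => q0z; rewrite r0E q0z; ring.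
have q10 : q1 != 0 by apply: contra_neq n11 => q1z; rewrite s1E q1z; ring.
have q20 : q2 != 0.
  by apply: contra_neq n22 => q2z; rewrite q2z r2z s2z; ring.
(* The sign of [q2] matches $e^{-\ell\gamma}$ in the third normal-form vertex and makes the relation
   symmetric. *)
exists p0, q0, p1, q1, p2, (- q2); split.
- by rewrite v0 v1 v2 r0E s0z r1z s1E r2z s2z opprK.
- by rewrite oppr_eq0.
- by split; [move: D0 | move: D1 | move: D2];
    rewrite ?s0z ?r1z ?r2z; congr (_ < _); ring.
(* Orthogonality to the three vertices determines the fourth normal up to the factor [u]; inserting
   this in [null] and clearing denominators gives [u ^+ 2] times the relation. *)
have kE : k = - u * p2 / q2.
  by apply: (mulIf q20); rewrite divfK //; move: o32; rewrite r2z s2z; lra.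
have nE : n = k + u * p0 / q0.
  apply: (mulIf q00); rewrite mulrDl divfK //.
  by move: o30; rewrite r0E s0z; lra.
have lE : l = - k - u * p1 / q1.
  apply: (mulIf q10); rewrite mulrBl divfK //.
  by move: o31; rewrite r1z s1E; lra.
have u2 : u ^+ 2 != 0 by rewrite expf_neq0.
apply: (mulfI u2); move/(congr1 ( *%R (q0 * q1 * q2))): null; rewrite mulr0.
move=> null; apply/eqP; rewrite -subr_eq0; apply/eqP; rewrite -[RHS]null.
by rewrite lE nE kE; field; rewrite q00 q10 q20.
Qed.

End StandardPosition.

(** * Angles *)

Section Angles.
Context {R : realType} {Lam : int}.
Context (hLam : [\/ Lam = -1, Lam = 0 | Lam = 1]).
Local Notation c := (@cL R Lam).
Local Notation s := (@sL R Lam).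

Lemma cLN t : c (- t) = c t.
Proof. by rewrite /cL opprK addrC cosN. Qed.

Lemma sLN t : s (- t) = - s t.
Proof.
by rewrite /sL opprK sinN; case: ifP => _; [ring | case: ifP].
Qed.

(** This is the imaginary part of $e^{\ell x}e^{\ell y}e^{\ell z}$; [Lam] enters through
    $\ell^2=-\Lambda$. *)
Lemma sL_sum3 x y z : s (x + y + z) =
  s x * c y * c z + c x * s y * c z + c x * c y * s z -
  Lam%:~R * (s x * s y * s z).
Proof.
case: hLam => ->; rewrite /sL /cL /=.
- rewrite !opprD !expRD !expRN; field.
  by rewrite !gt_eqF ?expR_gt0.
- by ring.
- by rewrite !(sinD, cosD); ring.
Qed.

Lemma sL_eq0 x : Lam != 1 -> s x = 0 -> x = 0.
Proof.
case: hLam => ->; rewrite /sL //= => _ /eqP.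
rewrite mulf_eq0 invr_eq0 pnatr_eq0 orbF subr_eq0 => /eqP /expR_inj; lra.
Qed.

(** The scale [k] may be negative, since points are projective; for [Lam = 1] this confines the
    angle to an open half turn. *)
Lemma polar (p t : R) : 0 < p ^+ 2 + Lam%:~R * t ^+ 2 -> t != 0 ->
  exists th k : R, [/\ k != 0, p = k * c th, t = k * s th &
    Lam = 1 -> 0 < th < pi].
Proof.
case: hLam => ->; rewrite /sL /cL /= => D0 t0.
- rewrite mulN1r subr_sqr in D0.
  have pt : p - t != 0 by apply: contraTneq D0 => ->; rewrite mul0r ltxx.
  have pt' : p + t != 0 by apply: contraTneq D0 => ->; rewrite mulr0 ltxx.
  have E0 : 0 < (p + t) / (p - t).
    rewrite -(pmulr_lgt0 _ (_ : 0 < (p - t) ^+ 2)) ?exprn_even_gt0 //.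
    by rewrite expr2 mulrA divfK // mulrC.
  (* Here [e] is the exponential of the angle: [p + t = k * e] and [p - t = k / e]. *)
  pose e := Num.sqrt ((p + t) / (p - t)).
  have e0 : 0 < e by rewrite sqrtr_gt0.
  have e2 : e ^+ 2 = (p + t) / (p - t) by rewrite sqr_sqrtr // ltW.
  have en : e != 0 by rewrite gt_eqF.
  exists (ln e), ((p - t) * e); split=> //.
  + by rewrite mulf_neq0.
  + rewrite expRN lnK ?posrE //; apply: (mulIf en).
    have -> : (p - t) * e * ((e + e^-1) / 2) * e =
        (p - t) * (e ^+ 2 + 1) / 2 * e by field.
    by rewrite e2; field.
  + rewrite expRN lnK ?posrE //; apply: (mulIf en).
    have -> : (p - t) * e * ((e - e^-1) / 2) * e =
        (p - t) * (e ^+ 2 - 1) / 2 * e by field.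
    by rewrite e2; field.
- have p0 : p != 0.
    by apply: contraTneq D0 => ->; rewrite mul0r addr0 expr0n ltxx.
  exists (t / p), p; split=> //; first by rewrite mulr1.
  by rewrite mulrCA divff // mulr1.
(* Giving [k] the sign of [t] makes [t / k] positive, so it is the sine of [acos (p / k)]. *)
- rewrite mul1r in D0; pose k := Num.sg t * Num.sqrt (p ^+ 2 + t ^+ 2).
  have k0 : k != 0 by rewrite mulf_neq0 ?sgr_eq0 // gt_eqF // sqrtr_gt0.
  have k2 : k ^+ 2 = p ^+ 2 + t ^+ 2.
    by rewrite exprMn sqr_sg t0 mul1r sqr_sqrtr // ltW.
  have x1 : (p / k) ^+ 2 < 1.
    rewrite exprMn exprVn k2 ltr_pdivrMr // mul1r ltrDl.
    by rewrite exprn_even_gt0.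
  have xb : -1 < p / k < 1.
    by rewrite -ltr_norml -(@expr_lt1 _ 2) // real_normK // num_real.
  have xb' : -1 <= p / k <= 1 by case/andP: xb => *; rewrite !ltW.
  exists (acos (p / k)), k; split=> //.
  + by rewrite acosK // mulrC divfK.
  + rewrite sin_acos // (_ : 1 - _ = (t / k) ^+ 2); last first.
      by rewrite !exprMn exprVn k2; field; rewrite gt_eqF.
    rewrite sqrtr_sqr normrM normrV ?unitfE // {2}/k normrM normr_sg t0 mul1r.
    rewrite [`|Num.sqrt _|]ger0_norm ?sqrtr_ge0 // /k.
    rewrite -mulrA [Num.sqrt _ * _]mulrC mulfVK;
      last by rewrite gt_eqF ?sqrtr_gt0.
    by rewrite -numEsg.
  + case/andP: xb => x0 x1' _; apply/andP; split.
      by apply: acos_gt0; rewrite (ltW x0).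
    by apply: acos_ltpi; rewrite x0 ltW.
Qed.

Lemma sin_eq0_lt3pi (x : R) : 0 < x < 3 * pi -> sin x = 0 ->
  x = pi \/ x = 2 * pi.
Proof.
have pi0 := pi_gt0 R.
case/andP=> x0 x3 sx.
have [xpi|xpi|] := ltgtP x pi; last by left.
  by have := @sin_gt0_pi _ x; rewrite x0 xpi sx ltxx => /(_ isT).
have [x2|x2|] := ltgtP x (2 * pi); last by right.
  have := @sin_gt0_pi _ (x - pi).
  rewrite sinB sx sinpi mulr0 mul0r subr0 ltxx => h.
  by suff: false by []; apply: h; apply/andP; split; lra.
have := @sin_gt0_pi _ (x - 2 * pi).
rewrite mulr_natl sinB sx sin2pi mulr0 mul0r subr0 ltxx => h.
by suff: false by []; apply: h; rewrite -mulr_natl; apply/andP; split; lra.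
Qed.

(** A half turn is absorbed by the sign of the scale, which allows the angle sum to be corrected by
    multiples of [pi]. *)
Lemma polar_shift (p t k th : R) : Lam = 1 ->
  p = k * c th -> t = k * s th ->
  p = - k * c (th - pi) /\ t = - k * s (th - pi).
Proof.
move=> L1 -> ->; rewrite /cL /sL L1 /= cosB sinB cospi sinpi; split; ring.
Qed.

Lemma angle_sum (p0 t0 p1 t1 p2 t2 : R) :
  0 < p0 ^+ 2 + Lam%:~R * t0 ^+ 2 -> 0 < p1 ^+ 2 + Lam%:~R * t1 ^+ 2 ->
  0 < p2 ^+ 2 + Lam%:~R * t2 ^+ 2 -> t0 != 0 -> t1 != 0 -> t2 != 0 ->
  p0 * p1 * t2 + p0 * t1 * p2 + t0 * p1 * p2 = Lam%:~R * (t0 * t1 * t2) ->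
  exists al be ga k0 k1 k2 : R, [/\ al + be + ga = 0,
    [/\ k0 != 0, p0 = k0 * c al & t0 = k0 * s al],
    [/\ k1 != 0, p1 = k1 * c be & t1 = k1 * s be],
    [/\ k2 != 0, p2 = k2 * c ga & t2 = k2 * s ga]
  & Lam = 1 -> [/\ 0 < `|al| < pi, 0 < `|be| < pi & 0 < `|ga| < pi]].
Proof.
move=> D0 D1 D2 /(polar D0)[al [k0 [k00 ep0 et0 al_pi]]].
move=> /(polar D1)[be [k1 [k10 ep1 et1 be_pi]]].
move=> /(polar D2)[ga [k2 [k20 ep2 et2 ga_pi]]] rel.
have s0 : s (al + be + ga) = 0.
  apply: (mulfI (_ : k0 * k1 * k2 != 0)); first by rewrite !mulf_neq0.
  rewrite sL_sum3 mulr0; move: rel; rewrite ep0 et0 ep1 et1 ep2 et2; lra.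
have [L1|L1] := eqVneq Lam 1; last first.
  exists al, be, ga, k0, k1, k2; split=> //; first exact: sL_eq0 s0.
  by move=> L; rewrite L eqxx in L1.
have [{}al_pi {}be_pi {}ga_pi] := And3 (al_pi L1) (be_pi L1) (ga_pi L1).
have pi0 := pi_gt0 R.
have norm_pos (x : R) : 0 < x < pi -> 0 < `|x| < pi.
  by case/andP=> x0 xpi; rewrite gtr0_norm // x0.
have norm_shift (x : R) : 0 < x < pi -> 0 < `|x - pi| < pi.
  case/andP=> x0 xpi; rewrite ltr0_norm ?subr_lt0 //.
  by apply/andP; split; lra.
have [ep2' et2'] := polar_shift L1 ep2 et2.
have [ep1' et1'] := polar_shift L1 ep1 et1.
have sin0 : sin (al + be + ga) = 0 by move: s0; rewrite /sL L1.
have bound : 0 < al + be + ga < 3 * pi.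
  case/andP: al_pi => ??; case/andP: be_pi => ??; case/andP: ga_pi => ??.
  by apply/andP; split; lra.
(* The sum is [pi] or [2 * pi]; turning one or two angles back by [pi] makes it 0 and keeps all
   absolute values between 0 and [pi]. *)
case: (sin_eq0_lt3pi bound sin0).
- move=> sum_pi; exists al, be, (ga - pi), k0, k1, (- k2).
  split; [lra | by [] | by [] | by split; rewrite ?oppr_eq0 |].
  by split; [apply: norm_pos | apply: norm_pos | apply: norm_shift].
- move=> sum_pi; exists al, (be - pi), (ga - pi), k0, (- k1), (- k2).
  split; [lra | by [] | by split; rewrite ?oppr_eq0
    | by split; rewrite ?oppr_eq0 |].
  by split; [apply: norm_pos | apply: norm_shift | apply: norm_shift].
Qed.

End Angles.

(** * Rigidity of the normal position *)

Section Uniqueness.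
Context {R : realType} {Lam : int}.
Local Notation C := (CL R Lam).
Local Notation M2 := 'M[C]_2.
Implicit Types (A B : M2).

Definition vertex0 (t : R) : M2 :=
  herm (cL Lam t) (sL Lam t) (- (2 * sL Lam t)) 0.
Definition vertex1 (t : R) : M2 := herm (cL Lam t) (sL Lam t) 0 (2 * sL Lam t).
Definition vertex2 (t : R) : M2 := herm (cL Lam t) (- sL Lam t) 0 0.

Lemma normal_positionE v A al be ga : normal_position v A al be ga <->
  [/\ samept (vertex0 al) (act A (v (inord 0))),
      samept (vertex1 be) (act A (v (inord 1))),
      samept (vertex2 ga) (act A (v (inord 2)))
    & samept 1%:M (act A (v (inord 3)))].
Proof.
rewrite /normal_position mx2_1 /expell !cLN !sLN.
have zE : 0 = mkCL 0 0 :> C by apply: cl_eq; rewrite !clE.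
have eE (x : R) : 2 * ell * x%:A = mkCL 0 (2 * x) :> C.
  by rewrite mkCLE scale0r add0r; apply: cl_eq; rewrite !clE; ring.
have eN (x : R) : - mkCL 0 x = mkCL 0 (- x) :> C.
  by apply: cl_eq; rewrite !clE ?oppr0.
by rewrite /vertex0 /vertex1 /vertex2 /herm !eE !eN opprK !zE.
Qed.

Lemma act_mx2 (a b c d x y z t : C) :
  act (mx2 a b c d) (mx2 x y z t) =
  mx2 ((a * x + b * z) * clconj d - (a * y + b * t) * clconj c)
      ((a * y + b * t) * clconj a - (a * x + b * z) * clconj b)
      ((c * x + d * z) * clconj d - (c * y + d * t) * clconj c)
      ((c * y + d * t) * clconj a - (c * x + d * z) * clconj b).
Proof. by rewrite /act mx2_circ !mxE2; congr mx2; ring. Qed.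

(** Subtracts a known equation from the goal and leaves an identity for [ring]. *)
Lemma eq_from (x y z t : C) : x = y -> z - t = x - y -> z = t.
Proof. by move=> -> /eqP; rewrite subrr subr_eq0 => /eqP. Qed.

(** A substitute for cancellation despite zero divisors: even [ell] is one when [Lam = 0], but a
    real factor can be recovered. *)
Lemma real_mul_imaginary_eq0 (w : C) (x : R) :
  clconj w = w -> x != 0 -> w * mkCL 0 x = 0 -> w = 0.
Proof.
move=> /(congr1 clIm); rewrite clE => wI x0 /(congr1 clIm); rewrite !clE mulr0.
rewrite addr0 => /eqP; rewrite mulf_eq0 (negbTE x0) orbF => /eqP wR.
by apply: cl_eq; rewrite clE //; lra.
Qed.

(** The zero entries of the images kill the off-diagonal entries of [A], and the others equate its
    diagonal entries. Source and target angles may differ, so uniqueness covers all choices of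
    parameters. *)
Lemma normal_position_stabilizer (A : M2) (k0 k1 k2 k3 : R)
    (al be ga al' be' ga' : R) :
  sL Lam al != 0 -> sL Lam be != 0 -> sL Lam ga != 0 ->
  inPGLplus A -> k3 != 0 ->
  act A (vertex0 al) = rscale k0 (vertex0 al') ->
  act A (vertex1 be) = rscale k1 (vertex1 be') ->
  act A (vertex2 ga) = rscale k2 (vertex2 ga') ->
  act A 1%:M = rscale k3 1%:M -> exists2 z : C, z \is a GRing.unit & A = z%:M.
Proof.
move=> sa sb sg; rewrite [A]mx2_eta.
move: (A 0 0) (A 0 1) (A 1 0) (A 1 1) => a b c d pA k30.
rewrite /vertex0 /vertex1 /vertex2 -mx2_1 !rscale_herm /herm mx2_rscale.
rewrite !act_mx2.
case/mx2_inj=> e000 e001 e010 _; case/mx2_inj=> _ e101 e110 _.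
case/mx2_inj=> _ e201 e210 _; case/mx2_inj=> e300 e301 e310 _.
have algN (x : R) : (- x)%:A = - x%:A :> C by rewrite scaleNr.
have alg2 (x : R) : (2 * x)%:A = 2 * x%:A :> C.
  by rewrite !mulr_natl -scalerMnl.
have alg0 : 0%:A = 0 :> C by rewrite scale0r.
have s2 (x : R) : x != 0 -> - (2 * x) != 0.
  by move=> x0; rewrite oppr_eq0 mulf_neq0 // pnatr_eq0.
have sq_real (z : C) : clconj (z * clconj z) = z * clconj z.
  by rewrite clconjM clconjK mulrC.
have ud : a * d - b * c \is a GRing.unit.
  by rewrite -mx2_det; apply: clnormsq_unit; rewrite gt_eqF.
have conj0 (z : C) : clconj z = 0 -> z = 0.
  by move=> z0; rewrite -[z]clconjK z0 clconj0.
have ab_sym : a * clconj b = b * clconj a by apply: (eq_from (esym e301)); ring.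
(* The diagonal entries of [vertex2 ga] differ by a nonzero multiple of [ell], and by [ab_sym] this
   difference annihilates [a * clconj b]. *)
have ab0 : a * clconj b = 0.
  apply: (real_mul_imaginary_eq0 _ (s2 _ sg)).
    by rewrite clconjM clconjK mulrC -ab_sym.
  move: e201; rewrite !(mkCLE, algN, alg0, mulr0) alg2.
  set P := (cL Lam ga)%:A; set S := (sL Lam ga)%:A => e201.
  apply: (eq_from (esym e201)).
  apply: (eq_from (congr1 ( *%R (P + S * ell)) (esym ab_sym))); ring.
have ba0 : b * clconj a = 0 by rewrite -ab_sym.
have bb0 : b * clconj b = 0.
  apply: (real_mul_imaginary_eq0 (sq_real b) (s2 _ sb)).
  move: e101; rewrite !(mkCLE, algN, alg0, mulr0) !alg2.
  set P := (cL Lam be)%:A; set S := (sL Lam be)%:A => e101.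
  apply: (eq_from e101).
  apply: (eq_from (congr1 ( *%R (P + S * ell)) ab0)).
  apply: (eq_from (congr1 ( *%R (- P + S * ell)) ba0)).
  ring.
have cd_sym : c * clconj d = d * clconj c by apply: (eq_from e310); ring.
have cd0 : c * clconj d = 0.
  apply: (real_mul_imaginary_eq0 _ (s2 _ sg)).
    by rewrite clconjM clconjK mulrC -cd_sym.
  move: e210; rewrite !(mkCLE, algN, alg0, mulr0) alg2.
  set P := (cL Lam ga)%:A; set S := (sL Lam ga)%:A => e210.
  apply: (eq_from e210).
  apply: (eq_from (congr1 ( *%R (- P - S * ell)) cd_sym)); ring.
have dc0 : d * clconj c = 0 by rewrite -cd_sym.
have cc0 : c * clconj c = 0.
  apply: (real_mul_imaginary_eq0 (sq_real c) (s2 _ sa)).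
  move: e010; rewrite !(mkCLE, algN, alg0, mulr0) !alg2.
  set P := (cL Lam al)%:A; set S := (sL Lam al)%:A => e010.
  apply: (eq_from (esym e010)).
  apply: (eq_from (congr1 ( *%R (P + S * ell)) cd0)).
  apply: (eq_from (congr1 ( *%R (- P + S * ell)) dc0)).
  ring.
(* A zero norm does not suffice here; instead [clconj b] times the unit determinant expands into
   products already known to vanish. *)
have b0 : b = 0.
  apply/conj0/(mulIr ud); rewrite mul0r.
  transitivity (d * (a * clconj b) - c * (b * clconj b)); first by ring.
  by rewrite ab0 bb0 !mulr0 subr0.
have c0 : c = 0.
  apply/conj0/(mulIr ud); rewrite mul0r.
  transitivity (a * (d * clconj c) - b * (c * clconj c)); first by ring.
  by rewrite dc0 cc0 !mulr0 subr0.
rewrite b0 c0 !(clconj0, mul0r, mulr0, mulr1, addr0, add0r, subr0)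
  in e300 e000 e001 *.
(* [A] is now diagonal with [a * clconj d = k3]; comparing this with the off-diagonal entry of
   [vertex0 al] yields [a * clconj a = k3], hence [d = a]. *)
have eS : k3 * sL Lam al = k0 * sL Lam al'.
  transitivity (clIm (a * mkCL (cL Lam al) (sL Lam al) * clconj d)).
    by rewrite mulrAC e300 !clE; ring.
  by rewrite e000 clE.
have aa : a * clconj a = k3%:A.
  apply/eqP; rewrite -subr_eq0; apply/eqP.
  apply: (real_mul_imaginary_eq0 _ (s2 _ sa)).
    by rewrite clconjD clconjN clconj_alg sq_real.
  rewrite mulrBl mulrAC e001; apply: cl_eq; rewrite !clE; first by ring.
  by rewrite mulrN -mulrN mulrN mulrCA -eS; ring.
have ua : a \is a GRing.unit.
  by have := alg_unit (Lam := Lam) k30; rewrite -aa unitrM => /andP[].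
exists a => //; have -> : d = a.
  rewrite -[d]clconjK -[a in RHS]clconjK; congr clconj.
  by apply: (mulrI ua); rewrite e300 aa.
by rewrite -scalemx1 -mx2_1 mx2Z !mulr0 mulr1.
Qed.

End Uniqueness.

(** * Existence and uniqueness of the normal position *)

Section NormalPosition.
Context {R : realType} {Lam : int}.
Context (hLam : [\/ Lam = -1, Lam = 0 | Lam = 1]).
Local Notation C := (CL R Lam).
Local Notation M2 := 'M[C]_2.
Implicit Types (A B : M2) (v : 'I_4 -> M2).

Lemma exists_normal_position v : lightlike_tetrahedron v ->
  exists A al be ga, [/\ inPGLplus A, al + be + ga = 0,
    normal_position v A al be ga,
    [/\ sL Lam al != 0, sL Lam be != 0 & sL Lam ga != 0]
  & Lam = 1 -> [/\ 0 < `|al| < pi, 0 < `|be| < pi & 0 < `|ga| < pi]].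
Proof.
case/tetrahedron_null_frame=> Z nf.
have [A0 [pA0 [r r0 e3]]] := act_to_one (nf_inX nf (inord 3)).
(* The transport lemma moves points by an adjugate; a double adjugate of a 2 by 2 matrix is the
   matrix itself. *)
have nf0 := null_frame_act (inPGLplus_adj pA0) nf.
rewrite mx2_adjK in nf0.
have [A1 [Z' [pA1 nf1 [r' r'0 e3'] [m0 [m1 [m2 [Z0 Z1 Z2]]]]]]] :=
  standard_null_frame nf0 r0 e3.
have [p0 [t0 [p1 [t1 [p2 [t2 [[v0 v1 v2] [t00 t10 t20] [D0 D1 D2] rel]]]]]]] :=
  standard_coordinates nf1 e3' Z0 Z1 Z2.
have [al [be [ga [k0 [k1 [k2 [sum0 K0 K1 K2 bd]]]]]]] :=
  angle_sum hLam D0 D1 D2 t00 t10 t20 rel.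
have [k00 ep0 et0] := K0; have [k10 ep1 et1] := K1; have [k20 ep2 et2] := K2.
exists (A1 *m A0), al, be, ga; split=> //; first exact: inPGLplusM.
  apply/normal_positionE; rewrite !actM v0 v1 v2 e3'.
  split; [exists k0 | exists k1 | exists k2 | exists r'] => //;
    rewrite rscale_herm ?mulr0; congr herm => //.
  - by rewrite et0; ring.
  - by rewrite et1; ring.
  - by rewrite et2; ring.
split.
- by apply: contra_neq t00 => s0; rewrite et0 s0 mulr0.
- by apply: contra_neq t10 => s0; rewrite et1 s0 mulr0.
- by apply: contra_neq t20 => s0; rewrite et2 s0 mulr0.
Qed.

(** [B *m \adj A] carries one normal form to the other, so it is scalar by
    [normal_position_stabilizer]. *)
Lemma normal_position_unique v A B al be ga al' be' ga' :
  [/\ sL Lam al != 0, sL Lam be != 0 & sL Lam ga != 0] ->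
  inPGLplus A -> inPGLplus B -> normal_position v A al be ga ->
  normal_position v B al' be' ga' -> samePGL A B.
Proof.
move=> [sa sb sg] pA pB /normal_positionE[a0 a1 a2 a3].
move=> /normal_positionE[b0 b1 b2 b3].
have transfer i (x y : M2) : samept x (act A (v i)) -> samept y (act B (v i)) ->
    exists2 k : R, k != 0 & act (B *m \adj A) x = rscale k y.
  case=> r r0 ex [r' r'0 ey].
  exists (r^-1 * (clnormsq (\det A) * r')).
    by rewrite !mulf_neq0 ?invr_eq0 // gt_eqF.
  apply: (rscale_inj r0); rewrite rscaleM mulVKf // -act_rscale -ex.
  by rewrite actM act_adj act_rscale ey rscaleM.
have [k0 _ e0] := transfer _ _ _ a0 b0.
have [k1 _ e1] := transfer _ _ _ a1 b1.
have [k2 _ e2] := transfer _ _ _ a2 b2.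
have [k3 k30 e3] := transfer _ _ _ a3 b3.
have pC : inPGLplus (B *m \adj A).
  by apply: inPGLplusM => //; apply: inPGLplus_adj.
have [z uz eC] := normal_position_stabilizer sa sb sg pC k30 e0 e1 e2 e3.
have uA : \det A \is a GRing.unit by apply: clnormsq_unit; rewrite gt_eqF.
exists ((\det A)^-1 * z); first by rewrite unitrM unitrV uA.
(* Multiply [B *m \adj A = z%:M] by [A] on the right. *)
have : z *: A = \det A *: B.
  by rewrite -mul_scalar_mx -eC -mulmxA mul_adj_mx mul_mx_scalar.
by move=> e; rewrite -scalerA e scalerA mulVr // scale1r.
Qed.

End NormalPosition.

Theorem proposition4p2 (R : realType) (Lam : int)
    (hLam : [\/ Lam = -1, Lam = 0 | Lam = 1])
    (v : 'I_4 -> 'M[CL R Lam]_2) (hv : lightlike_tetrahedron v) :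
  exists A : 'M[CL R Lam]_2,
    [/\ inPGLplus A,
        exists al be ga : R, al + be + ga = 0 /\ normal_position v A al be ga,
        forall B : 'M[CL R Lam]_2, inPGLplus B ->
          (exists al be ga : R,
             al + be + ga = 0 /\ normal_position v B al be ga) ->
          samePGL A B
      & Lam = 1 ->
          exists al be ga : R,
            [/\ al + be + ga = 0, normal_position v A al be ga,
                0 < `|al| < pi, 0 < `|be| < pi & 0 < `|ga| < pi]].
Proof.
have [A [al [be [ga [pA sum0 nA s0 bd]]]]] := exists_normal_position hLam hv.
exists A; split=> //; first by exists al, be, ga.
  move=> B pB [al' [be' [ga' [_ nB]]]].
  exact: normal_position_unique s0 pA pB nA nB.
by move=> /bd[]; exists al, be, ga.
Qed.
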